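(* For any polytopes $B_1,\ldots,B_n$ in $\mathbb{R}^n$ and the convex hull $B$ of their union, we have $$(B-B_1)\cdot(B-B_2)\cdot\ldots\cdot(B-B_n)=0,$$ where the left-hand side is expanded as a polynomial in $B,B_1,\ldots,B_n$ and each resulting degree $n$ monomial is interpreted as the corresponding mixed volume.
   Context: The mixed volume of polytopes $A_1,\ldots,A_n$ in $\mathbb{R}^n$, denoted by the monomial $A_1\cdot\ldots\cdot A_n$, is the coefficient of the monomial $x_1\cdots x_n$ in the polynomial $\mathrm{Vol}(x_1A_1+\ldots+x_nA_n)$ of $x_1,\ldots,x_n\ge 0$. For a homogeneous polynomial $P(x_1,\ldots,x_m)=\sum c_{a_1,\ldots,a_m}x_1^{a_1}\cdots x_m^{a_m}$ of degree $n$ and polytopes $A_1,\ldots,A_m$ in $\mathbb{R}^n$, one defines $P(A_1,\ldots,A_m)=\sum c_{a_1,\ldots,a_m}A_1^{a_1}\cdots A_m^{a_m}$, where $A_1^{a_1}\cdots A_m^{a_m}$ is the mixed volume of the $n$-tuple of polytopes in which $A_i$ is repeated $a_i$ times. Thus $(B-B_1)\cdots(B-B_n)=\sum_{I\subset\{1,\ldots,n\}}(-1)^{|I|}B^{n-|I|}\prod_{i\in I}B_i$. *)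

(* Defs.v *)
From HB Require Import structures.
From mathcomp Require Import all_boot all_order all_algebra.
(* mpoly has to be imported before the analysis files: in the other order their
   notations clash. *)
From mathcomp Require Import mpoly.
From mathcomp Require Import all_classical all_reals all_analysis.

Set Implicit Arguments.
Unset Strict Implicit.
Unset Printing Implicit Defensive.

Import Order.TTheory GRing.Theory Num.Theory.

Local Open Scope classical_set_scope.
Local Open Scope ring_scope.

(* Not inferable from the library: its sigma-finite instance for \x is shadowed
   by the one for subprobabilities. *)
Lemma product_measure_sigma_finite d1 d2 (T1 : measurableType d1)
    (T2 : measurableType d2) (R : realType)
    (m1 : {sigma_finite_measure set T1 -> \bar R})
    (m2 : {sigma_finite_measure set T2 -> \bar R}) :
  sigma_finite setT (m1 \x m2)%E.
Proof.
have /sigma_finiteP[F [TF ndF Foo]] := sigma_finiteT m1.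
have /sigma_finiteP[G [TG ndG Goo]] := sigma_finiteT m2.
exists (fun n => F n `*` G n).
  rewrite -setXTT TF TG predeqE => -[x y]; split.
    move=> [/= [n _ Fnx] [k _ Gky]]; exists (maxn n k) => //; split.
    - by move: x Fnx; exact/subsetPset/ndF/leq_maxl.
    - by move: y Gky; exact/subsetPset/ndG/leq_maxr.
  by move=> [n _ []/= ? ?]; split; exists n.
move=> k; have [? ?] := Foo k; have [? ?] := Goo k.
split; first exact: measurableX.
by rewrite product_measure1E// lte_mul_pinfty// ge0_fin_numE.
Qed.

Section Lebesgue_tuple.
Context {R : realType}.
Local Notation T := (measurableTypeR R).

Definition tuple_cons n (p : T * n.-tuple T) : n.+1.-tuple T :=
  [the n.+1.-tuple T of p.1 :: p.2].

Lemma measurable_tuple_cons n : measurable_fun setT (@tuple_cons n).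
Proof. exact: measurable_cons. Qed.

Section cons_measure.
Context n (mu : {sigma_finite_measure set (n.-tuple T) -> \bar R}).

Definition cons_measure : set (n.+1.-tuple T) -> \bar R :=
  pushforward (lebesgue_measure \x mu)%E (@tuple_cons n).

Let measurable_preimage_cons A :
  measurable A -> measurable (@tuple_cons n @^-1` A).
Proof.
by move=> mA; rewrite -[X in measurable X]setTI; exact: measurable_tuple_cons.
Qed.

Let cons_measure0 : cons_measure set0 = 0%E.
Proof. by rewrite /cons_measure /pushforward preimage_set0 measure0. Qed.

Let cons_measure_ge0 A : (0 <= cons_measure A)%E.
Proof. by rewrite /cons_measure /pushforward measure_ge0. Qed.

Let cons_measure_sigma_additive : semi_sigma_additive cons_measure.
Proof.
move=> F mF tF mUF; rewrite /cons_measure /pushforward preimage_bigcup.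
apply: measure_semi_sigma_additive.
- by move=> i; exact: measurable_preimage_cons.
- apply/trivIsetP => /= i j _ _ ij; rewrite -preimage_setI.
  by move/trivIsetP : tF => /(_ _ _ _ _ ij) ->//; rewrite preimage_set0.
- by rewrite -preimage_bigcup; exact: measurable_preimage_cons.
Qed.

HB.instance Definition _ := isMeasure.Build _ _ _ cons_measure
  cons_measure0 cons_measure_ge0 cons_measure_sigma_additive.

Lemma sigma_finite_cons_measure : sigma_finite setT cons_measure.
Proof.
pose g (t : n.+1.-tuple T) : T * n.-tuple T := (thead t, [tuple of behead t]).
have mg : measurable_fun setT g.
  apply/measurable_fun_pairP; split; first exact: measurable_tnth.
  exact: measurable_behead.
have gK : cancel (@tuple_cons n) g.
  by case=> x t; congr pair; apply: val_inj.
have [F UF mF] := product_measure_sigma_finite lebesgue_measure mu.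
exists (fun k => g @^-1` F k); first by rewrite -preimage_bigcup -UF.
move=> k; have [mFk Fk] := mF k; split.
  by rewrite -[X in measurable X]setTI; exact: mg.
rewrite /cons_measure /pushforward -comp_preimage.
by rewrite (_ : g \o @tuple_cons n = id)//; apply/funext => p; exact: gK.
Qed.

HB.instance Definition _ :=
  Measure_isSigmaFinite.Build _ _ _ cons_measure sigma_finite_cons_measure.

End cons_measure.

Fixpoint lebesgue_tuple n : {sigma_finite_measure set (n.-tuple T) -> \bar R} :=
  match n with
  | 0 => @dirac _ (0.-tuple T) [tuple] R
  | m.+1 => cons_measure (lebesgue_tuple m)
  end.

End Lebesgue_tuple.

Section MixedVolume.
Context {R : realType} {n : nat}.
Implicit Types A B : set 'rV[R]_n.

Definition convex_hull A : set 'rV[R]_n :=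
  smallest (@convex_set R 'rV[R]_n) A.

Definition polytope A := exists s : seq 'rV[R]_n,
  s != [::] /\ A = convex_hull [set` s].

(* Real-valued, through fine: only meaningful on measurable sets of finite
   measure, such as polytopes. *)
Definition volume A : R :=
  fine (lebesgue_tuple n [set t | A (\row_(i < n) tnth t i)]).

Definition minkowski_comb m (x : 'I_m -> R) (A_ : 'I_m -> set 'rV[R]_n) :
    set 'rV[R]_n :=
  [set v | exists2 a : 'I_m -> 'rV[R]_n,
    forall i, A_ i (a i) & v = \sum_(i < m) x i *: a i].

(* The polynomial function x |-> Vol(x_1 A_1 + ... + x_n A_n) on x >= 0, as a
   formal polynomial; it is unique since the nonnegative orthant is
   Zariski-dense, and it exists, for polytopes, by Minkowski's theorem. *)
Definition volume_poly (A_ : 'I_n -> set 'rV[R]_n) : {mpoly R[n]} :=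
  xget 0 [set P | forall x : 'I_n -> R, (forall i, 0 <= x i) ->
    P.@[x] = volume (minkowski_comb x A_)].

(* Not divided by n!: the mixed volume of n copies of A is n! Vol(A). *)
Definition mixed_volume (A_ : 'I_n -> set 'rV[R]_n) : R :=
  (volume_poly A_)@_[multinom 1%N | i < n].

(* The polytopes A_j, each listed a_j times. *)
Definition repeat_bodies m (A_ : 'I_m -> set 'rV[R]_n) (a : 'X_{1..m}) :
    seq (set 'rV[R]_n) :=
  flatten [seq nseq (a j) (A_ j) | j <- enum 'I_m].

(* P(A_1, ..., A_m) for P homogeneous of degree n: repeat_bodies A_ a has
   exactly n items when a is a monomial of degree n, so that the default set0
   is not used. *)
Definition mixed_eval m (P : {mpoly R[m]}) (A_ : 'I_m -> set 'rV[R]_n) : R :=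
  \sum_(a <- msupp P)
    P@_a * mixed_volume (fun i => nth set0 (repeat_bodies A_ a) i).

End MixedVolume.

(* Main.v *)
Require Import Defs.
From mathcomp Require Import all_boot all_order all_algebra.
From mathcomp Require Import perm finmap mpoly.
From mathcomp Require Import all_classical all_reals all_analysis.
From mathcomp Require Import measurable_realfun.
From mathcomp Require Import ring lra zify.

Set Implicit Arguments.
Unset Strict Implicit.
Unset Printing Implicit Defensive.

Import Order.TTheory GRing.Theory Num.Theory.
Import numFieldNormedType.Exports.

Local Open Scope classical_set_scope.
Local Open Scope ring_scope.

(** Why the theorem is true. For a set I of indices let K_I be the Minkowski
    sum of the B_i with i in I and of n - |I| copies of B. The heart of the
    proof is an identity between indicator functions,
      sum_I (-1)^|I| 1_{K_I} = 0,
    valid for any number of convex bodies in any dimension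
    ([hull_inclusion_exclusion]). Fix a point p, and let S be the set of the
    weights l >= 0 of total n for which p lies in sum_i l_i B_i. As the B_i are
    convex, so is S, and p lies in K_I exactly when some l in S has l_i >= 1 for
    all i in I ([hull_layerP]). Weights of total n cannot all be below 1, so the
    half-spaces {l_i >= 1} cover S, and the alternating number of the
    subfamilies that have a common point in S vanishes, because S and its
    sections are convex and thus have Euler characteristic 1 or 0
    ([halfspace_cover_euler]). Integration of the identity gives
    sum_I (-1)^|I| Vol(K_I) = 0 ([volume_sum_indic]).

    It remains to see that this sum is the product of the B - B_i. Let P be the
    polynomial of the volume of y B + sum_i x_i B_i, homogeneous of degree n. An
    n-fold mixed difference of such a polynomial does not depend on the base
    point and is additive in each of the n directions: it is n! times the polar
    form ([mixed_difference_homog]). Its values at unit vectors are the mixed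
    volumes ([mixed_volumeE]), so expanding the product gives its value in the
    directions e_0 - e_i. Computed from the base point sum_i e_i instead of the
    origin, this value is the sum of the (-1)^|I| Vol(K_I) ([polar_sum_sub],
    [mixed_eval_prod_sub]).

    The existence of P is Minkowski's theorem ([minkowski_volume_poly]), and
    follows from the same identity, now for the vertices v_1, ..., v_N of a
    polytope A, scaled by h, and with a further convex summand C. In that case
    K_I is a translate of C + (N - |I|) h A, so the differences of order N of
    t |-> Vol(C + t A) vanish for every step h ([volume_difference]). As this
    function is monotone, it is a polynomial ([function_of_differences]). A
    function that is polynomial in each variable is polynomial, and the scaling
    of Lebesgue measure makes it homogeneous of degree n. *)

(** * Lebesgue measure under affine maps *)

Section AffineLebesgue.
Context {R : realType}.
Local Notation T := (measurableTypeR R).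

Lemma measurable_affine (c w : R) :
  measurable_fun setT (fun x : T => c * x + w : T).
Proof. by apply: measurable_funD => //; apply: measurable_funM. Qed.

(** The bundled measure behind [pushforward], so that it can be scaled and
    integrated against. *)
Definition pushforward_affine (c w : R) : {measure set T -> \bar R} :=
  measure_function_pushforward__canonical__measure_function_Measure
    lebesgue_measure (measurable_affine c w).

Lemma lebesgue_measure_affine (c w : R) (A : set T) : 0 < c -> measurable A ->
  (c%:E * lebesgue_measure ((fun x : T => (c * x + w)%R : T) @^-1` A) =
   lebesgue_measure A)%E.
Proof.
move=> c0 mA; pose phi (x : T) : T := c * x + w.
pose cn : {nonneg R} := NngNum (ltW c0).
pose mu : {measure set T -> \bar R} := mscale cn (pushforward_affine c w).
rewrite -[LHS]/(mu A); apply/esym/lebesgue_measure_unique => //= _ [[a b]] _ <-.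
rewrite /mu /= /mscale /= /pushforward.
have -> : phi @^-1` [set` Interval (BRight a) (BRight b)] =
          [set` Interval (BRight ((a - w) / c)) (BRight ((b - w) / c))].
  apply/seteqP; split => x /=; rewrite !in_itv /= /phi ltr_pdivrMr//;
    by rewrite ler_pdivlMr// => /andP[? ?]; apply/andP; split; lra.
rewrite !lebesgue_measure_itv /= !lte_fin ltr_pM2r ?invr_gt0// ltrD2r.
case: ifP => // ab.
  by rewrite -EFinM; congr (_%:E); field; rewrite gt_eqF.
by rewrite mule0.
Qed.

(** Fubini: the section at x of the preimage is the preimage of the section at
    c x + w_0, so that each coordinate contributes one factor c. *)
Lemma lebesgue_tuple_affine (n : nat) (c : R) (w : n.-tuple R)
    (A : set (n.-tuple T)) : 0 < c -> measurable A ->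
  ((c ^+ n)%:E * lebesgue_tuple n
     ((fun t : n.-tuple T =>
        [tuple (c * tnth t i + tnth w i)%R : T | i < n]) @^-1` A) =
   lebesgue_tuple n A)%E.
Proof.
move=> c0; elim: n w A => [|n IHn] w A mA.
  rewrite expr0 mul1e; congr (lebesgue_tuple 0 _).
  apply/seteqP; split => t /=; set u := (X in A X -> _) => Au;
    set v := (X in A X); suff -> : v = u by [].
    by apply: eq_from_tnth => -[].
  by apply: eq_from_tnth => -[].
pose phi m (v : m.-tuple R) (t : m.-tuple T) :=
  [tuple (c * tnth t i + tnth v i : T) | i < m].
have mphi m v : measurable_fun setT (phi m v).
  apply/measurable_fun_tnthP => i.
  rewrite (_ : _ \o _ = fun t : m.-tuple T => c * tnth t i + tnth v i).
    by apply: measurable_funD => //; apply: measurable_funM => //;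
       exact: measurable_tnth.
  by apply/funext => t /=; rewrite tnth_mktuple.
pose S := @tuple_cons R n @^-1` A.
have mS : measurable S.
  by rewrite /S -[X in measurable X]setTI; exact: measurable_tuple_cons.
pose G (x : T) := lebesgue_tuple n (xsection S x).
have mG : measurable_fun setT G by exact: measurable_fun_xsection.
have consE x t : phi n.+1 w (tuple_cons (x, t)) =
    tuple_cons (c * x + thead w, phi n [tuple of behead w] t).
  apply: eq_from_tnth => i; rewrite tnth_mktuple.
  case: (unliftP ord0 i) => [j ->|->]; last by rewrite /thead !(tnth_nth 0).
  rewrite [RHS](_ : _ = tnth (phi n [tuple of behead w] t) j).
    rewrite tnth_mktuple; congr (c * _ + _); rewrite !(tnth_nth 0) //=.
    by rewrite nth_behead.
  by rewrite !(tnth_nth 0).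
have secE x : xsection (@tuple_cons R n @^-1` (phi n.+1 w @^-1` A)) x =
    phi n [tuple of behead w] @^-1` xsection S (c * x + thead w).
  by apply/seteqP; split => t; rewrite /xsection /= !inE /S /= consE.
rewrite [LHS](_ : _ = (c%:E * ((c ^+ n)%:E *
    \int[lebesgue_measure]_x lebesgue_tuple n
       (phi n [tuple of behead w] @^-1` xsection S (c * x + thead w)%R)))%E);
  last first.
  rewrite exprS EFinM muleA; congr (_ * _)%E.
  rewrite /= /cons_measure /pushforward /product_measure1.
  by apply: eq_integral => x _ /=; rewrite secE.
have mGv : measurable_fun setT (fun x : T => G (c * x + thead w)).
  exact: (measurableT_comp mG (measurable_affine _ _)).
pose H (x : T) := lebesgue_tuple n
       (phi n [tuple of behead w] @^-1` xsection S (c * x + thead w)%R).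
have GH x : G (c * x + thead w) = ((c ^+ n)%:E * H x)%E.
  by rewrite /H IHn//; exact: measurable_xsection.
have cn0 : 0 < c ^+ n by rewrite exprn_gt0.
have mH : measurable_fun setT H.
  rewrite (_ : H = (fun x => ((c ^+ n)^-1)%:E * G (c * x + thead w)%R)%E).
    by apply: measurable_funeM.
  apply/funext => x; rewrite GH muleA -EFinM mulVf ?mul1e// gt_eqF//.
rewrite -ge0_integralZl_EFin//; last exact: ltW.
under eq_integral => x _ do rewrite -GH.
pose cn : {nonneg R} := NngNum (ltW c0).
pose mu : {measure set T -> \bar R} :=
  mscale cn (pushforward_affine c (thead w)).
transitivity (\int[mu]_x G x)%E.
  rewrite ge0_integral_mscale//; congr (_ * _)%E.
  by rewrite ge0_integral_pushforward//; exact: measurable_affine.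
rewrite /= /cons_measure /pushforward /= /product_measure1.
apply: eq_measure_integral => B mB _.
exact: lebesgue_measure_affine.
Qed.
End AffineLebesgue.

(** * Compact sets have a finite volume *)

Section CompactVolume.
Context {R : realType} {n : nat}.
Local Notation T := (measurableTypeR R).
Implicit Types A K : set 'rV[R]_n.

Definition tuple_set A : set (n.-tuple T) :=
  [set t | A (\row_(i < n) tnth t i)].

(** Balls of the sup norm are boxes. *)
Lemma measurable_tuple_ball (x : 'rV[R]_n) (e : R) :
  measurable (tuple_set (ball x e)).
Proof.
have [e0|e0] := ltP 0 e; last first.
  rewrite (_ : tuple_set _ = set0)//; apply/seteqP; split => // t [].
  by rewrite ltNge e0.
rewrite (_ : tuple_set _ =
    \bigcap_(i : 'I_n) ((@tnth n T)^~ i @^-1` ball (x ord0 i) e)).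
  apply: fin_bigcap_measurable => // i _.
  rewrite -[X in measurable X]setTI; apply: measurable_tnth => //.
  exact: measurable_ball.
apply/seteqP; split => t /=.
  by move=> [_ te] i _ /=; have := te ord0 i; rewrite mxE.
by move=> te; split => // i j; rewrite ord1 mxE; exact: te.
Qed.

(** Measurable sets of tuples are generated by conditions on single coordinates,
    so a compact set is written as a countable intersection of finite unions of
    balls, one union for each radius 1 / (k + 1). *)
Lemma measurable_tuple_compact K : compact K -> measurable (tuple_set K).
Proof.
move=> cK.
have clK : closed K by apply: compact_closed cK; exact: norm_hausdorff.
have e0 k : 0 < k.+1%:R^-1 :> R by [].
have cov k : exists F : set 'rV[R]_n, [/\ finite_set F, F `<=` K &
    K `<=` \bigcup_(x in F) ball x k.+1%:R^-1].
  move: (cK); rewrite compact_cover => /(_ _ K (fun x => ball x k.+1%:R^-1)).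
  case=> [x _|x Kx|F FK KF]; first exact: ball_open.
    by exists x => //; exact: ballxx.
  by exists [set` F]; split => // x Fx; have := FK x Fx; rewrite inE.
pose F k := projT1 (cid (cov k)).
rewrite (_ : tuple_set K = \bigcap_k \bigcup_(x in F k)
    tuple_set (ball x k.+1%:R^-1)).
  apply: bigcapT_measurable => k; apply: fin_bigcup_measurable.
    by have [] := projT2 (cid (cov k)).
  by move=> x _; exact: measurable_tuple_ball.
apply/seteqP; split => t /=.
  move=> Kt k _; have [_ _ KF] := projT2 (cid (cov k)).
  by have [x Fx xt] := KF _ Kt; exists x.
move=> Ht; apply: clK => V /nbhs_ballP[e /= e_gt0 eV].
have [k ke] : exists k, k.+1%:R^-1 < e.
  by have [k] := @ltr_add_invr R 0 e e_gt0; rewrite add0r; exists k.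
have [x Fx xt] := Ht k I; exists x; split.
  by have [_ FK _] := projT2 (cid (cov k)); exact: FK.
by apply: eV; apply: (le_ball (ltW ke)); apply: ball_sym.
Qed.
End CompactVolume.

Section CompactVolumeFinite.
Context {R : realType}.
Local Notation T := (measurableTypeR R).

Lemma measurable_tuple_box n (M : R) :
  measurable [set t : n.-tuple T | forall i, tnth t i \in `[(- M)%R, M]%R].
Proof.
rewrite (_ : [set _ | _] =
    \bigcap_(i : 'I_n) ((@tnth n T)^~ i @^-1` [set` `[- M, M]])).
  apply: fin_bigcap_measurable => // i _.
  by rewrite -[X in measurable X]setTI; apply: measurable_tnth.
by apply/seteqP; split => t /= h i; [move=> _; exact: h | exact: h i I].
Qed.

Lemma lebesgue_tuple_box_lty n (M : R) :
  (lebesgue_tuple n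
    [set t : n.-tuple T | forall i, tnth t i \in `[(- M)%R, M]%R] < +oo)%E.
Proof.
elim: n => [|n IHn].
  by rewrite /= diracE; case: (_ \in _); rewrite ltry.
rewrite /= /cons_measure /pushforward.
rewrite (_ : _ @^-1` _ = [set` `[- M, M]] `*`
    [set t : n.-tuple T | forall i, tnth t i \in `[(- M)%R, M]%R]).
  rewrite product_measure1E//; last exact: measurable_tuple_box.
  apply: lte_mul_pinfty => //.
  by rewrite ge0_fin_numE//= lebesgue_measure_itv/=; case: ifP; rewrite ltry.
apply/seteqP; split => -[x t] /=.
  move=> h; split; first by have := h ord0; rewrite (tnth_nth 0).
  by move=> i; have := h (lift ord0 i); rewrite !(tnth_nth 0).
move=> [hx ht] i; case: (unliftP ord0 i) => [j ->|->].
  by have := ht j; rewrite !(tnth_nth 0).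
by rewrite (tnth_nth 0).
Qed.

Lemma lebesgue_tuple_compact_lty n (K : set 'rV[R]_n) : compact K ->
  (lebesgue_tuple n (tuple_set K) < +oo)%E.
Proof.
move=> cK; have [M [_ KM]] := compact_bounded cK.
have {KM} KM : forall x, K x -> `|x| <= M + 1 by apply: KM; rewrite ltrDl.
apply: le_lt_trans (lebesgue_tuple_box_lty n (M + 1)).
apply: le_measure; rewrite ?inE; [exact: measurable_tuple_compact |
  exact: measurable_tuple_box |].
move=> t /KM tM i; rewrite in_itv /= -ler_norml; apply: le_trans tM.
have /mapP[j Hj e] : `|tnth t i| \in
    [seq `|(\row_(i < n) tnth t i) x.1 x.2| | x : 'I_1 * 'I_n].
  by apply/mapP; exists (ord0, i) => //=; rewrite ?mem_enum ?mxE.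
rewrite e [leRHS]/Num.norm /= mx_normrE.
by apply/bigmax_geP; right => /=; exists j.
Qed.
End CompactVolumeFinite.

Section VolumeFacts.
Context {R : realType} {n : nat}.
Local Notation T := (measurableTypeR R).
Implicit Types (A K : set 'rV[R]_n).

Lemma fin_num_tuple_compact K : compact K ->
  lebesgue_tuple n (tuple_set K) \is a fin_num.
Proof.
by move=> cK; rewrite ge0_fin_numE//; exact: lebesgue_tuple_compact_lty.
Qed.

Lemma le_volume A K : compact A -> compact K -> A `<=` K ->
  volume A <= volume K.
Proof.
move=> cA cK AK; apply: fine_le; try exact: fin_num_tuple_compact.
apply: le_measure; rewrite ?inE; try exact: measurable_tuple_compact.
by move=> t; exact: AK.
Qed.

Lemma compact_affine (c : R) (w : 'rV[R]_n) K : compact K ->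
  compact [set c *: v + w | v in K].
Proof.
move=> cK; apply: continuous_compact => //; apply: continuous_subspaceT => v.
apply: (@cvgD _ _ _ (nbhs v) _ ( *:%R c) (fun=> w)); last exact: cvg_cst.
exact: scaler_continuous.
Qed.

(** The translation invariance and the scaling law of the volume in one
    statement. *)
Lemma volume_affine (c : R) (w : 'rV[R]_n) K : 0 < c -> compact K ->
  volume [set c *: v + w | v in K] = c ^+ n * volume K.
Proof.
move=> c0 cK; have cA := @compact_affine c w K cK.
have mA := measurable_tuple_compact cA.
have cn0 : 0 < c ^+ n by rewrite exprn_gt0.
have := lebesgue_tuple_affine [tuple w ord0 i | i < n] c0 mA.
set D := (X in lebesgue_tuple n X) => E; have {E} := E.
have -> : D = tuple_set K.
  apply/seteqP; split => t; rewrite /D /tuple_set /=.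
    move=> [v Kv]; set u := \row_i _ => e.
    suff uE : u = c *: (\row_i tnth t i) + w.
      by move: e; rewrite uE => /addIr /scalerI <-//; rewrite gt_eqF.
    by apply/rowP => i; rewrite !mxE !tnth_mktuple.
  move=> Kt; exists (\row_i tnth t i) => //.
  by apply/rowP => i; rewrite !mxE !tnth_mktuple.
by rewrite /volume => <-; rewrite fineM// fin_num_tuple_compact.
Qed.

(** Linear relations between indicator functions pass to volumes: integrate
    them. *)
Lemma volume_sum_indic (J : finType) (s : J -> R) (K : J -> set 'rV[R]_n) :
  (forall j, compact (K j)) ->
  (forall p, \sum_j s j * (`[< K j p >])%:R = 0) ->
  \sum_j s j * volume (K j) = 0.
Proof.
move=> cK sK; have mK j := measurable_tuple_compact (cK j).
pose f j (t : n.-tuple T) : \bar R := ((s j)%:E * (\1_(tuple_set (K j)) t)%:E)%E.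
have intf1 j : (lebesgue_tuple n).-integrable setT
    (fun t => (\1_(tuple_set (K j)) t)%:E).
  apply/integrableP; split; first exact/measurable_EFinP.
  rewrite (eq_integral (fun t => (\1_(tuple_set (K j)) t)%:E)); last first.
    by move=> t _; rewrite gee0_abs// lee_fin.
  by rewrite integral_indic// setIT; exact: lebesgue_tuple_compact_lty.
have intf j : (lebesgue_tuple n).-integrable setT (f j) by exact: integrableZl.
apply: EFin_inj; rewrite -sumEFin.
have -> : (\sum_j (s j * volume (K j))%:E =
    \sum_j \int[lebesgue_tuple n]_t f j t)%E.
  apply: eq_bigr => j _; rewrite integralZl// integral_indic// setIT EFinM.
  by rewrite /volume fineK//; exact: fin_num_tuple_compact.
rewrite -integral_sum//.
rewrite -[RHS](integral0 (lebesgue_tuple n) setT).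
apply: eq_integral => t _ /=; rewrite /f.
under eq_bigr => j _ do rewrite -EFinM.
rewrite sumEFin; congr (_%:E); rewrite -[RHS](sK (\row_i tnth t i)).
by apply: eq_bigr => j _; rewrite indicE.
Qed.

End VolumeFacts.

(** * An Euler relation for convex sets of weights *)

Lemma big_subsetU1 (V : nmodType) (J : finType) (m : J) (D : {set J})
    (F : {set J} -> V) : m \notin D ->
  \sum_(I : {set J} | I \subset (m |: D)%SET) F I =
  \sum_(I : {set J} | I \subset D) (F I + F (m |: I)%SET).
Proof.
move=> mD; rewrite big_split /= (bigID (fun I : {set J} => m \in I)) /= addrC.
congr (_ + _).
  apply: eq_bigl => I; apply/andP/idP => [[ID mI]|ID].
    apply/fintype.subsetP => j jI; have := fintype.subsetP ID j jI.
    by rewrite !inE => /orP[/eqP jm|//]; rewrite -jm jI in mI.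
  split; first exact: (fintype.subset_trans ID (finset.subsetUr _ _)).
  by apply: contra mD => /(fintype.subsetP ID).
rewrite (reindex_onto (fun I => m |: I)%SET (fun I => I :\ m)%SET) /=; last first.
  by move=> I /andP[_ mI]; rewrite finset.setD1K.
apply: eq_bigl => I; rewrite finset.setU11 andbT.
apply/andP/idP => [[ID /eqP mI]|ID].
  have mI' : m \notin I by rewrite -mI !inE eqxx.
  apply/fintype.subsetP => j jI; have := fintype.subsetP ID j.
  rewrite !inE jI orbT => /(_ isT) /orP[/eqP jm|//].
  by rewrite -jm jI in mI'.
split; first exact: finset.setUS.
by rewrite finset.setU1K//; apply: contra mD => /(fintype.subsetP ID).
Qed.

Section HalfspaceEuler.
Context {R : realType} {J : finType}.
Implicit Types (S : set (J -> R)) (D I : {set J}).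

Definition weights_convex S := forall (l m : J -> R) (t : R),
  0 <= t <= 1 -> S l -> S m -> S (fun j => t * l j + (1 - t) * m j).

Definition inhabited_nat S : nat := `[< exists l, S l >].

(** The Euler characteristic of a convex set is 1 or 0, according to whether it
    is inhabited. This is its additivity along a hyperplane: by convexity, a set
    with points on both sides meets the hyperplane. *)
Lemma inhabited_split S (j : J) (h : R) : weights_convex S ->
  (inhabited_nat S + inhabited_nat (S `&` [set l | l j = h]) =
   inhabited_nat (S `&` [set l | (h <= l j)%R]) +
   inhabited_nat (S `&` [set l | (l j <= h)%R]))%N.
Proof.
move=> cS; rewrite /inhabited_nat.
case: asboolP => [[s Ss]|S0]; last first.
  by do 3 (case: asboolP => [[l [Sl _]]|_]; first by case: S0; exists l).
case: (asboolP (exists l, (S `&` [set l | h <= l j]) l)) =>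
    [[u [Su /= hu]]|nge].
  case: (asboolP (exists l, (S `&` [set l | l j <= h]) l)) =>
      [[v [Sv /= hv]]|nle].
    case: asboolP => // neq; exfalso; apply: neq.
    have [uv|uv] := eqVneq (u j) (v j).
      by exists u; split => //=; apply: le_anti; rewrite hu uv hv.
    have uv0 : 0 < u j - v j.
      by rewrite subr_gt0 lt_neqAle eq_sym uv (le_trans hv hu).
    pose t := (h - v j) / (u j - v j).
    exists (fun j => t * u j + (1 - t) * v j); split.
      apply: cS => //; rewrite /t divr_ge0 ?subr_ge0 ?(le_trans hv hu)//=.
      by rewrite ler_pdivrMr// mul1r lerD2r.
    by rewrite /= /t; field; rewrite gt_eqF.
  case: asboolP => // -[l [Sl /= lh]]; case: nle.
  by exists l; split => //=; rewrite lh.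
case: asboolP => [[l [Sl /= lh]]|_].
  by case: nge; exists l; split => //=; rewrite lh.
case: asboolP => // nle; exfalso.
by have [hs|hs] := leP h (s j); [apply: nge|apply: nle];
  exists s; split => //=; exact: ltW.
Qed.

(** The half-spaces l_i >= h with i in D cover S, because the total of the
    weights is at least |D| h. Induction on D: cut S along l_m = h. On the part
    l_m <= h and on the section l_m = h, the weights other than l_m still have a
    total of at least (|D| - 1) h, and the terms of S for D are those of the part
    minus those of the section for D minus m. This is why the hypothesis bounds
    the total below instead of fixing it. *)
Lemma halfspace_cover_euler S (h : R) D :
  D != finset.set0 -> weights_convex S ->
  (forall l, S l -> h *+ #|D| <= \sum_(j in D) l j) ->
  \sum_(I : {set J} | I \subset D)
    (-1) ^+ #|I| *
    (inhabited_nat (S `&` [set l | forall i, i \in I -> h <= l i]))%:R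
  = 0 :> R.
Proof.
move: {2}#|D| (leqnn #|D|) => k; elim: k D S => [|k IHk] D S Dk D0 cS hS.
  by move: Dk; rewrite leqn0 cards_eq0 (negPf D0).
have /set0Pn[m mD] := D0.
have mD' : m \notin (D :\ m)%SET by rewrite !inE eqxx.
rewrite -(finset.setD1K mD) big_subsetU1//.
pose G (X : set (J -> R)) (I : {set J}) : R :=
  (-1) ^+ #|I| *
  (inhabited_nat (X `&` [set l | forall i, i \in I -> h <= l i]))%:R.
pose Sle := S `&` [set l | l m <= h]; pose Seq := S `&` [set l | l m = h].
have step (I : {set J}) : I \subset (D :\ m)%SET ->
    G S I + G S (m |: I)%SET = G Sle I - G Seq I.
  move=> ID; have mI : m \notin I by apply: contra mD' => /(fintype.subsetP ID).
  rewrite /G cardsU1 mI add1n exprS mulN1r mulNr -!mulrBr; congr (_ * _).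
  pose SI := S `&` [set l | forall i, i \in I -> h <= l i].
  have cSI : weights_convex SI.
    move=> l l' t t01 [Sl hl] [Sl' hl']; split; first exact: cS.
    move=> i iI /=; have /andP[t0 t1] := t01.
    have := hl i iI; have := hl' i iI; nra.
  have := inhabited_split m h cSI.
  have -> : SI `&` [set l | l m = h] =
      Seq `&` [set l | forall i, i \in I -> h <= l i] by rewrite /SI /Seq setIAC.
  have -> : SI `&` [set l | l m <= h] =
      Sle `&` [set l | forall i, i \in I -> h <= l i] by rewrite /SI /Sle setIAC.
  have -> : SI `&` [set l | h <= l m] =
      S `&` [set l | forall i, i \in (m |: I)%SET -> h <= l i].
    apply/seteqP; split => l /=.
      by move=> [[Sl hl] hm]; split => // i /setU1P[->//|]; exact: hl.
    move=> [Sl hl]; split; last by apply: hl; rewrite setU11.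
    by split => // i iI; apply: hl; rewrite setU1r.
  by move=> /(congr1 (fun k : nat => k%:R : R)); rewrite !natrD /SI => E; lra.
rewrite (eq_bigr _ step).
have hD l : S l ->
    h *+ #|(D :\ m)%SET| + h <= \sum_(j in (D :\ m)%SET) l j + l m.
  move=> /hS; rewrite (cardsD1 m D) mD add1n mulrSr => /le_trans; apply.
  rewrite (bigD1 m)//= addrC lerD2r le_eqVlt; apply/orP; left.
  by apply/eqP/eq_bigl => j; rewrite !inE andbC.
(* If D = {m}, then S lies in l_m >= h, so the part and the section agree. *)
have [D'0|D'0] := eqVneq (D :\ m)%SET finset.set0.
  rewrite D'0 big1// => I; rewrite finset.subset0 => /eqP ->.
  rewrite /G -mulrBr (_ : Sle = Seq) ?subrr ?mulr0//.
  apply/seteqP; split => l [Sl /= lm]; split => //=; last by rewrite lm.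
  apply/le_anti; rewrite lm /=.
  by have := hD l Sl; rewrite D'0 cards0 big_set0 mulr0n !add0r.
rewrite sumrB; have Dk' : (#|(D :\ m)%SET| <= k)%N.
  by move: Dk; rewrite (cardsD1 m D) mD.
rewrite IHk// ?IHk ?subrr//.
- move=> l l' t t01 [Sl /= hl] [Sl' /= hl']; split; first exact: cS.
  by rewrite /= hl hl'; ring.
- by move=> l [Sl /= lm]; have := hD l Sl; rewrite lm lerD2r.
- move=> l l' t t01 [Sl /= hl] [Sl' /= hl']; split; first exact: cS.
  by have /andP[t0 t1] := t01; move=> /=; nra.
- by move=> l [Sl /= lm]; have := hD l Sl; lra.
Qed.
End HalfspaceEuler.

(** * Convex hulls of unions, and their inclusion-exclusion formula *)

Section ConvexSets.
Context {R : realType} {V : lmodType R}.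
Implicit Types A C : set V.

Lemma convex_setP A : convex_set (A : set (convex_lmodType V)) <->
  forall x y (t : R), 0 <= t <= 1 -> A x -> A y -> A (t *: x + (1 - t) *: y).
Proof.
split=> [cA x y t t01 Ax Ay|cA x y t].
  pose t' : {i01 R} := Itv01 (proj1 (andP t01)) (proj2 (andP t01)).
  by have := cA x y t' (mem_set Ax) (mem_set Ay); rewrite inE.
rewrite !inE => Ax Ay.
by apply: (cA x y t%:num) => //; rewrite ge0 le1.
Qed.

(** [convex_set] on the type of vectors itself rather than on its alias as a
    convex space. *)
Definition is_convex A := convex_set (A : set (convex_lmodType V)).

(** The multiples of a convex set by nonnegative scalars add up like the
    scalars: a C + b C = (a + b) C. *)
Lemma convex_add2 C (a b : R) x y : is_convex C -> 0 <= a -> 0 <= b ->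
  C x -> C y -> exists2 z, C z & a *: x + b *: y = (a + b) *: z.
Proof.
move=> /convex_setP cC a0 b0 Cx Cy; have [ab0|ab0] := eqVneq (a + b) 0.
  exists x => //; have /andP[/eqP -> /eqP ->] : (a == 0) && (b == 0).
    by rewrite -paddr_eq0// ab0.
  by rewrite addr0 !scale0r addr0.
exists ((a / (a + b)) *: x + (1 - a / (a + b)) *: y).
  have ab_gt0 : 0 < a + b by rewrite lt_neqAle eq_sym ab0 addr_ge0.
  by apply: cC => //; rewrite divr_ge0 ?addr_ge0//= ler_pdivrMr// mul1r lerDl.
by rewrite scalerDr !scalerA; congr (_ *: _ + _ *: _); field.
Qed.

Lemma convex_sum (J : Type) (r : seq J) C (l : J -> R) (c : J -> V) c0 :
  is_convex C -> C c0 -> (forall j, 0 <= l j) -> (forall j, C (c j)) ->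
  exists2 z, C z & \sum_(j <- r) l j *: c j = (\sum_(j <- r) l j) *: z.
Proof.
move=> cC Cc0 l0 Cc; elim: r => [|j r [z Cz IH]].
  by exists c0 => //; rewrite !big_nil scale0r.
rewrite !big_cons IH; apply: convex_add2 => //.
by apply: sumr_ge0 => i _; exact: l0.
Qed.

Lemma is_convex_set1 (v : V) : is_convex [set v].
Proof.
apply/convex_setP => x y t _ /= -> ->.
by rewrite -scalerDl addrC subrK scale1r.
Qed.

Lemma smallest_convex A : is_convex (smallest (@convex_set R V) A).
Proof.
apply/convex_setP => x y t t01 Ax Ay B [cB AB].
by move: (cB) => /convex_setP; apply => //; [exact: Ax|exact: Ay].
Qed.

End ConvexSets.

Section HullOfUnion.
Context {R : realType} {n : nat} {J : finType}.
Variable B : J -> set 'rV[R]_n.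
Hypothesis convB : forall j, is_convex (B j).
Hypothesis neB : forall j, B j !=set0.
Implicit Types (C : set 'rV[R]_n) (p : 'rV[R]_n) (j : J).

Lemma hull_unionP j0 p : convex_hull (\bigcup_j B j) p <->
  exists l b, [/\ forall j, 0 <= l j, \sum_j l j = 1, forall j, B j (b j) &
    p = \sum_j l j *: b j].
Proof.
split; last first.
  move=> [l [b [l0 l1 Bb ->]]] C [cC BC].
  have [z Cz ->] := @convex_sum _ _ _ (index_enum J) C l b (b j0) cC
    (BC _ (ex_intro2 _ _ j0 I (Bb j0))) l0
    (fun j => BC _ (ex_intro2 _ _ j I (Bb j))).
  by rewrite l1 scale1r.
pose D : set 'rV[R]_n := [set p | exists l b, [/\ forall j, 0 <= l j,
  \sum_j l j = 1, forall j, B j (b j) & p = \sum_j l j *: b j]].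
move=> /(_ D); apply; split => [|q [i _ Biq]].
  apply/convex_setP => x y t /andP[t0 t1].
  move=> [l [b [l0 l1 Bb ->]]] [m [d [m0 m1 Bd ->]]].
  have t1' : 0 <= 1 - t by rewrite subr_ge0.
  have /choice[z zP] j : exists z, B j z /\
      (t * l j) *: b j + ((1 - t) * m j) *: d j =
      (t * l j + (1 - t) * m j) *: z.
    have [z Bz e] := convex_add2 (@convB j) (mulr_ge0 t0 (l0 j))
      (mulr_ge0 t1' (m0 j)) (Bb j) (Bd j).
    by exists z.
  exists (fun j => t * l j + (1 - t) * m j), z; split.
  - by move=> j; rewrite addr_ge0// mulr_ge0.
  - by rewrite big_split /= -!mulr_sumr l1 m1 !mulr1 addrC subrK.
  - by move=> j; have [] := zP j.
  - rewrite !scaler_sumr -big_split /=; apply: eq_bigr => j _.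
    by have [_ <-] := zP j; rewrite !scalerA.
have /choice[b Bb] j : exists z, B j z by have [z] := neB j; exists z.
exists (fun j => (j == i)%:R), (fun j => if j == i then q else b j); split.
- by move=> j; rewrite ler0n.
- by rewrite (bigD1 i)//= eqxx big1 ?addr0// => j /negPf ->.
- by move=> j; case: eqP => [->|].
- rewrite (bigD1 i)//= eqxx scale1r big1 ?addr0// => j /negPf ->.
  by rewrite scale0r.
Qed.

(** The body C + h sum_(j in I) B_j + h (|J| - |I|) B, where B is the hull of
    the union of the B_j. *)
Definition hull_layer C (h : R) (I : {set J}) : set 'rV[R]_n :=
  [set p | exists c b q, [/\ C c, forall j, B j (b j),
     convex_hull (\bigcup_j B j) q &
     p = c + h *: \sum_(j in I) b j + (h *+ (#|J| - #|I|)) *: q]].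

(** Membership of p, for all I at once, is read off from one set of weights: the
    copies of B spread their weight over the B_j, each of which has weight at
    least h if it is in I. This turns the bodies into half-spaces. *)
Lemma hull_layerP C (h : R) (I : {set J}) j0 p : 0 <= h ->
  hull_layer C h I p <->
  exists l, [/\ (forall j, 0 <= l j), \sum_j l j = h *+ #|J|,
    (exists c b, [/\ C c, forall j, B j (b j) & p = c + \sum_j l j *: b j]) &
    forall j, j \in I -> h <= l j].
Proof.
move=> h0.
have hI : \sum_j (if j \in I then h else 0) = h *+ #|I|.
  by rewrite -big_mkcond /= sumr_const.
have hbI (b : J -> 'rV[R]_n) :
    \sum_j (if j \in I then h else 0) *: b j = h *: \sum_(j in I) b j.
  rewrite scaler_sumr [RHS]big_mkcond /=; apply: eq_bigr => j _.
  by case: ifP; rewrite ?scale0r.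
split=> [[c [b [q [Cc Bb /(hull_unionP j0)[m [d [m0 m1 Bd ->]]] ->]]]]|].
  pose k := h *+ (#|J| - #|I|).
  have k0 : 0 <= k by rewrite mulrn_wge0.
  have if0 j : 0 <= if j \in I then h else 0 by case: ifP.
  have /choice[z zP] j : exists z, B j z /\
      (if j \in I then h else 0) *: b j + (k * m j) *: d j =
      ((if j \in I then h else 0) + k * m j) *: z.
    have [z Bz e] := convex_add2 (@convB j) (if0 j)
      (mulr_ge0 k0 (m0 j)) (Bb j) (Bd j).
    by exists z.
  exists (fun j => (if j \in I then h else 0) + k * m j); split.
  - by move=> j; rewrite addr_ge0// mulr_ge0.
  - by rewrite big_split /= hI -mulr_sumr m1 mulr1 /k -mulrnDr subnKC// max_card.
  - exists c, z; split => //; first by move=> j; have [] := zP j.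
    rewrite -addrA -hbI; congr (_ + _); rewrite scaler_sumr -big_split /=.
    by apply: eq_bigr => j _; have [_ <-] := zP j; rewrite scalerA.
  - by move=> j -> ; rewrite lerDl mulr_ge0.
move=> [l [l0 lJ [c [b [Cc Bb ->]]] lI]].
have m0 j : 0 <= l j - (if j \in I then h else 0).
  by rewrite subr_ge0; case: ifP => // jI; exact: lI.
have BU j : (\bigcup_j B j) (b j) by exists j.
have [q Hq e] := convex_sum (index_enum J) (@smallest_convex _ _ _)
  (sub_gen_smallest (BU j0)) m0 (fun j => sub_gen_smallest (BU j)).
exists c, b, q; split => //; rewrite -addrA -hbI; congr (_ + _).
have -> : h *+ (#|J| - #|I|) = \sum_j (l j - (if j \in I then h else 0)).
  by rewrite sumrB lJ hI mulrnBr// max_card.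
rewrite -e -big_split /=; apply: eq_bigr => j _.
by rewrite -scalerDl addrC subrK.
Qed.

(** The weights l for which p lies in C + sum_j l_j B_j form a convex set, to
    which the Euler relation applies. *)
Lemma hull_inclusion_exclusion C (h : R) p : (0 < #|J|)%N -> 0 <= h ->
  is_convex C ->
  \sum_(I : {set J}) (-1) ^+ #|I| * (`[< hull_layer C h I p >])%:R = 0 :> R.
Proof.
move=> /card_gt0P[j0 _] h0 cC.
pose S := [set l : J -> R | [/\ (forall j, 0 <= l j), \sum_j l j = h *+ #|J| &
  exists c b, [/\ C c, forall j, B j (b j) & p = c + \sum_j l j *: b j]]].
have cS : weights_convex S.
  move=> l m t /andP[t0 t1] [l0 l1 [c [b [Cc Bb pE]]]].
  move=> [m0 m1 [c' [b' [Cc' Bb' pE']]]].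
  have t1' : 0 <= 1 - t by rewrite subr_ge0.
  have /choice[z zP] j : exists z, B j z /\
      (t * l j) *: b j + ((1 - t) * m j) *: b' j =
      (t * l j + (1 - t) * m j) *: z.
    have [z Bz e] := convex_add2 (@convB j) (mulr_ge0 t0 (l0 j))
      (mulr_ge0 t1' (m0 j)) (Bb j) (Bb' j).
    by exists z.
  split.
  - by move=> j; rewrite addr_ge0// mulr_ge0.
  - by rewrite big_split /= -!mulr_sumr l1 m1 -mulrDl addrC subrK mul1r.
  - exists (t *: c + (1 - t) *: c'), z; split.
    + by move: cC => /convex_setP; apply => //; rewrite t0.
    + by move=> j; have [] := zP j.
    + transitivity (t *: p + (1 - t) *: p).
        by rewrite -scalerDl addrC subrK scale1r.
      rewrite {1}pE pE' !scalerDr addrACA; congr (_ + _).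
      rewrite !scaler_sumr -big_split /=; apply: eq_bigr => j _.
      by have [_ <-] := zP j; rewrite !scalerA.
have D0 : [set: J]%SET != finset.set0 by apply/set0Pn; exists j0; rewrite inE.
have hS l : S l -> h *+ #|[set: J]%SET| <= \sum_(j in [set: J]%SET) l j.
  move=> [_ lE _]; rewrite cardsT -lE le_eqVlt; apply/orP; left.
  by apply/eqP/eq_bigl => j; rewrite inE.
rewrite -[RHS](halfspace_cover_euler D0 cS hS).
apply: eq_big => [I|I _]; first by rewrite finset.subsetT.
congr (_ * (nat_of_bool _)%:R); apply: asbool_equiv_eq.
apply: iff_trans (hull_layerP C I j0 p h0) _; split.
  by move=> [l [? ? ? ?]]; exists l; split.
by move=> [l [[? ? ?] ?]]; exists l; split.
Qed.

End HullOfUnion.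

(** * Minkowski combinations and polytopes *)

Section MinkowskiComb.
Context {R : realType} {n m : nat}.
Implicit Types (A : 'I_m -> set 'rV[R]_n) (x : 'I_m -> R).

Lemma minkowski_comb_convex x A : (forall i, is_convex (A i)) ->
  is_convex (minkowski_comb x A).
Proof.
move=> cA; apply/convex_setP => _ _ t t01 [a Aa ->] [b Ab ->].
exists (fun i => t *: a i + (1 - t) *: b i).
  by move=> i; have /convex_setP := @cA i; apply.
rewrite !scaler_sumr -big_split /=; apply: eq_bigr => i _.
by rewrite scalerDr !scalerA [t * _]mulrC [(1 - t) * _]mulrC.
Qed.

(** Continuity for the product topology, in which products of compact sets are
    compact. *)
Lemma sum_scale_continuous (J : finType) (V : normedModType R) (x : J -> R) :
  continuous (fun a : prod_topology (fun _ : J => V) => \sum_j x j *: a j : V).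
Proof.
elim: (index_enum J) => [|j r IH].
  rewrite [X in continuous X](_ : _ = fun=> 0); first exact: cst_continuous.
  by apply/funext => a; rewrite big_nil.
pose g (a : prod_topology (fun _ : J => V)) : V :=
  x j *: a j + \sum_(j <- r) x j *: a j.
rewrite [X in continuous X](_ : _ = g); last first.
  by apply/funext => a; rewrite big_cons.
move=> a; apply: (@cvgD _ _ _ (nbhs a) _
  (fun a : prod_topology (fun _ : J => V) => x j *: a j)
  (fun a : prod_topology (fun _ : J => V) => \sum_(j <- r) x j *: a j)).
  apply: (@cvg_comp _ _ _ (fun a : prod_topology (fun _ : J => V) => a j)
    ( *:%R (x j)) _ (nbhs (a j))); last exact: scaler_continuous.
  exact: (@proj_continuous J (fun=> V) j a).
exact: IH.
Qed.

Lemma minkowski_comb_compact x A : (forall i, compact (A i)) ->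
  compact (minkowski_comb x A).
Proof.
move=> cA.
pose U := prod_topology (fun _ : 'I_m => 'rV[R]_n).
have -> : minkowski_comb x A =
    (fun a : U => \sum_j x j *: a j) @` [set a | forall i, A i (a i)].
  by apply/seteqP; split => [_ [a Aa ->]|_ [a Aa <-]]; exists a.
apply: (@continuous_compact U 'rV[R]_n (fun a : U => \sum_j x j *: a j)).
  by apply: continuous_subspaceT; exact: sum_scale_continuous.
exact: (@tychonoff _ (fun _ : 'I_m => 'rV[R]_n) A).
Qed.

Definition single_weight (j : 'I_m) (k : R) : 'I_m -> R :=
  fun i => if i == j then k else 0.

Lemma minkowski_comb_addw x A (j : 'I_m) (k : R) p : is_convex (A j) ->
  0 <= x j -> 0 <= k ->
  minkowski_comb (fun i => x i + single_weight j k i) A p <->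
  exists c q, [/\ minkowski_comb x A c, A j q & p = c + k *: q].
Proof.
move=> cA xj0 k0.
have sE (a : 'I_m -> 'rV[R]_n) :
    \sum_i (x i + single_weight j k i) *: a i = \sum_i x i *: a i + k *: a j.
  under eq_bigr => i _ do rewrite scalerDl.
  rewrite big_split /=; congr (_ + _); rewrite (bigD1 j)//= /single_weight eqxx.
  by rewrite big1 ?addr0// => i /negPf ->; rewrite scale0r.
split=> [[a Aa ->]|[_ [q [[a Aa ->] Aq ->]]]].
  by exists (\sum_i x i *: a i), (a j); split => //; exists a.
have [z Az e] := convex_add2 cA xj0 k0 (Aa j) Aq.
exists (fun i => if i == j then z else a i).
  by move=> i; case: eqP => [->|].
rewrite (bigD1 j)//= [RHS](bigD1 j)//= eqxx /single_weight eqxx -e addrAC.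
congr (_ + _); apply: eq_bigr => i /negPf ->.
by rewrite addr0.
Qed.

(** A body that is listed several times counts with the sum of its
    coefficients, by convexity. *)
Lemma minkowski_comb_comp m' (f : 'I_m' -> 'I_m) (x : 'I_m' -> R) A :
  (forall i, is_convex (A i)) -> (forall i, A i !=set0) ->
  (forall i, 0 <= x i) ->
  minkowski_comb x (A \o f) =
  minkowski_comb (fun k => \sum_(i | f i == k) x i) A.
Proof.
move=> cA neA x0; apply/seteqP; split => [_ [a Aa ->]|_ [a Aa ->]].
  have /choice[a0 Aa0] k : exists a, A k a by have [z] := neA k; exists z.
  have /choice[z zP] k : exists z, A k z /\
      \sum_(i | f i == k) x i *: a i = (\sum_(i | f i == k) x i) *: z.
    have l0 i : 0 <= if f i == k then x i else 0 by case: ifP.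
    have Ac i : A k (if f i == k then a i else a0 k).
      by case: eqP => [<-|_]; [exact: Aa|exact: Aa0].
    have [z Az e] := convex_sum (index_enum 'I_m') (@cA k) (Aa0 k) l0 Ac.
    exists z; split => //; rewrite big_mkcond /=.
    have -> : \sum_(i | f i == k) x i =
        \sum_i (if f i == k then x i else 0) by rewrite big_mkcond.
    rewrite -e.
    by apply: eq_bigr => i _; case: ifP; rewrite ?scale0r.
  exists z; first by move=> k; have [] := zP k.
  rewrite (partition_big f xpredT)//=; apply: eq_bigr => k _.
  by have [_ <-] := zP k.
exists (a \o f); first by move=> i; exact: Aa.
rewrite [RHS](partition_big f xpredT)//=; apply: eq_bigr => k _.
by rewrite scaler_suml; apply: eq_bigr => i /eqP ->.
Qed.

End MinkowskiComb.

Section Polytopes.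
Context {R : realType} {n : nat}.
Implicit Types (A : set 'rV[R]_n) (s : seq 'rV[R]_n).

Lemma bigcup_nth s : \bigcup_(j : 'I_(size s)) [set s`_j] = [set` s].
Proof.
apply/seteqP; split => [v [j _ ->]|v /= vs]; first exact: mem_nth.
have vs' : (index v s < size s)%N by rewrite index_mem.
by exists (Ordinal vs') => //=; rewrite nth_index.
Qed.

Lemma polytope_convex A : polytope A -> is_convex A.
Proof. by move=> [s [_ ->]]; exact: smallest_convex. Qed.

Lemma polytope_nonempty A : polytope A -> A !=set0.
Proof.
move=> [s [s0 ->]]; case: s s0 => // v s _; exists v; apply: sub_gen_smallest.
by rewrite /= inE eqxx.
Qed.

Lemma simplex_compact (J : finType) :
  compact [set l : prod_topology (fun _ : J => R) |
    (forall j, 0 <= l j) /\ \sum_j l j = 1].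
Proof.
pose U := prod_topology (fun _ : J => R).
have -> : [set l : U | (forall j, 0 <= l j) /\ \sum_j l j = 1] =
    [set l : U | forall j, `[0, 1]%classic (l j)] `&`
    ((fun l : U => \sum_j 1 *: (l j : R^o)) @^-1` [set 1]).
  apply/seteqP; split => l /= [l0 l1].
    split; last by rewrite /= -[RHS]l1; apply: eq_bigr => j _; rewrite scale1r.
    move=> j; rewrite in_itv /= l0 -[leRHS]l1 (bigD1 j)//= lerDl.
    exact: sumr_ge0.
  split; first by move=> j; have := l0 j; rewrite in_itv /= => /andP[].
  by rewrite -[RHS]l1; apply: eq_bigr => j _; rewrite scale1r.
apply: compact_closedI.
  apply: (@tychonoff _ (fun _ : J => R) (fun=> `[0, 1]%classic)).
  by move=> _; exact: segment_compact.
apply: closed_comp; last exact: (@closed_eq R 1).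
by move=> l _; exact: (@sum_scale_continuous R J R^o).
Qed.

(** A polytope is the image of a simplex, which is compact, under a linear
    map. *)
Lemma polytope_compact A : polytope A -> compact A.
Proof.
move=> [s [s0 ->]]; pose J := 'I_(size s).
have j0 : J by case: s s0 @J => // v s _; exact: ord0.
pose U := prod_topology (fun _ : J => R).
rewrite -bigcup_nth.
have -> : convex_hull (\bigcup_(j : J) [set s`_j]) =
    (fun l : U => \sum_j l j *: s`_j) @`
    [set l : U | (forall j, 0 <= l j) /\ \sum_j l j = 1].
  have cv (j : J) : is_convex [set s`_j] by exact: is_convex_set1.
  have ne (j : J) : [set s`_j] !=set0 by exists s`_j.
  apply/seteqP; split => p.
    move=> /(hull_unionP cv ne j0)[l [b [l0 l1 bE ->]]]; exists l => //.
    by apply: eq_bigr => j _; rewrite bE.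
  move=> [l [l0 l1] <-]; apply/(hull_unionP cv ne j0).
  by exists l, (fun j : J => s`_j).
apply: (@continuous_compact U 'rV[R]_n); last exact: simplex_compact.
apply: continuous_subspaceT; rewrite /U /J.
elim: (index_enum _) => [|j r IH].
  rewrite [X in continuous X](_ : _ = fun=> 0); first exact: cst_continuous.
  by apply/funext => l; rewrite big_nil.
pose g (l : U) : 'rV[R]_n := l j *: s`_j + \sum_(j <- r) l j *: s`_j.
rewrite [X in continuous X](_ : _ = g); last first.
  by apply/funext => l; rewrite big_cons.
move=> l; apply: (@cvgD _ _ _ (nbhs l) _ (fun l : U => l j *: s`_j)
  (fun l : U => \sum_(j <- r) l j *: s`_j)); last exact: IH.
apply: (@cvg_comp _ _ _ (fun l : U => l j) (fun k : R => k *: s`_j) _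
  (nbhs (l j))).
  exact: (@proj_continuous J (fun=> R) j l).
exact: scalel_continuous.
Qed.

Lemma polytope_hull_union (J : finType) (j0 : J) (B : J -> set 'rV[R]_n) :
  (forall j, polytope (B j)) -> polytope (convex_hull (\bigcup_j B j)).
Proof.
move=> /choice[s sP]; exists (flatten [seq s j | j <- enum J]).
have inS j v : v \in s j -> v \in flatten [seq s j | j <- enum J].
  by move=> vs; apply/flatten_mapP; exists j => //; rewrite mem_enum.
split.
  have [] := sP j0; case: (s j0) (inS j0) => // v r /(_ v); rewrite inE eqxx.
  by move=> /(_ isT); case: flatten.
apply/seteqP; split; apply: smallest_sub; try exact: smallest_convex.
  move=> v [j _]; have [_ ->] := sP j; apply: smallest_sub => [|u /= us].
    exact: smallest_convex.
  by apply: sub_gen_smallest; exact: inS us.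
move=> v /= /flatten_mapP[j _ vs]; apply: sub_gen_smallest; exists j => //.
by have [_ ->] := sP j; apply: sub_gen_smallest.
Qed.

End Polytopes.

(** * Mixed differences of products of affine forms *)

Section MixedDifference.
Context {K : comNzRingType}.

Lemma sum_sign_subset (J : finType) (D : {set J}) :
  \sum_(I : {set J} | I \subset D) (-1) ^+ #|I| = (D == finset.set0)%:R :> K.
Proof.
have [->|/set0Pn[m mD]] := eqVneq D finset.set0.
  rewrite (big_pred1 finset.set0) ?cards0 ?expr0// => I.
  by rewrite finset.subset0.
rewrite -(finset.setD1K mD) big_subsetU1 ?inE ?eqxx//.
rewrite big1// => I ID; rewrite cardsU1.
have -> : m \notin I by apply/negP => /(fintype.subsetP ID); rewrite !inE eqxx.
by rewrite add1n exprS mulN1r subrr.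
Qed.

(** For the expansion of products in which [None] stands for the constant term
    of each factor. *)
Lemma sum_option (J : finType) (Q : pred (option J)) (F : option J -> K) :
  Q None -> \sum_(o | Q o) F o = F None + \sum_(j | Q (Some j)) F (Some j).
Proof.
move=> QN; rewrite (bigD1 None)//=; congr (_ + _).
rewrite (reindex_omap Some id) /=; last by case=> [j|/andP[]].
by apply: eq_bigl => j; rewrite eqxx !andbT.
Qed.

(** Expand the product: a choice g of one term in each factor, [None] for the
    base point and [Some j] for the direction j, occurs for the sets I that avoid
    the directions it uses. The signs of these I cancel unless g uses all the
    directions. *)
Lemma mixed_difference_prod (J : finType) (d : nat) (x : 'I_d -> K)
    (u : 'I_d -> J -> K) :
  \sum_(I : {set J}) (-1) ^+ #|I| *
     \prod_(k < d) (x k + \sum_(j | j \notin I) u k j) =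
  \sum_(g : {ffun 'I_d -> option J} | [forall j, Some j \in codom g])
     \prod_(k < d) (if g k is Some j then u k j else x k).
Proof.
pose Q (I : {set J}) :=
  [pred o : option J | if o is Some j then j \notin I else true].
pose F k (o : option J) := if o is Some j then u k j else x k.
have prodE (I : {set J}) : \prod_(k < d) (x k + \sum_(j | j \notin I) u k j) =
    \sum_(g in ffun_on (Q I)) \prod_k F k (g k).
  rewrite -bigA_distr_big; apply: eq_bigr => k _.
  by rewrite sum_option.
under eq_bigr => I _ do rewrite prodE mulr_sumr.
rewrite (exchange_big_dep xpredT)//= [RHS]big_mkcond /=; apply: eq_bigr => g _.
rewrite -mulr_suml -[RHS]mul1r.
pose D := [set j | Some j \notin codom g]%SET.
have -> : \sum_(I : {set J} | g \in ffun_on (Q I)) (-1) ^+ #|I| =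
    (D == finset.set0)%:R :> K.
  rewrite -sum_sign_subset; apply: eq_bigl => I; apply/ffun_onP/fintype.subsetP.
    move=> gQ j jI; rewrite inE; apply/negP => /codomP[k gk].
    by have := gQ k; rewrite inE -gk jI.
  move=> ID k; rewrite inE /=; case gk : (g k) => [j|//].
  apply/negP => /ID; rewrite inE => /negP; apply; apply/codomP.
  by exists k.
have -> : (D == finset.set0) = [forall j, Some j \in codom g].
  apply/eqP/forallP => [D0 j|gs].
    by apply: contraFT (finset.in_set0 j) => gj; rewrite -D0 inE.
  by apply/setP => j; rewrite !inE gs.
by case: ifP; rewrite ?mul0r ?mulr0.
Qed.

(** Fewer factors than directions cannot use all the directions. *)
Lemma mixed_difference_prod0 (J : finType) (d : nat) (x : 'I_d -> K)
    (u : 'I_d -> J -> K) : (d < #|J|)%N ->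
  \sum_(I : {set J}) (-1) ^+ #|I| *
     \prod_(k < d) (x k + \sum_(j | j \notin I) u k j) = 0.
Proof.
move=> dJ; rewrite mixed_difference_prod big_pred0// => g.
apply/negP => /forallP gs; have := leq_image_card g 'I_d.
rewrite card_ord leqNgt => /negP; apply; apply: (leq_trans dJ).
have injS : injective (@Some J) by move=> ? ? [->].
rewrite -(card_imset predT injS) subset_leq_card//.
by apply/fintype.subsetP => _ /imsetP[j _ ->]; exact: gs.
Qed.

(** With as many factors as directions, a choice that uses all directions is a
    permutation: the base point drops out, and a permanent is left. *)
Lemma mixed_difference_prod_perm (n : nat) (x : 'I_n -> K)
    (u : 'I_n -> 'I_n -> K) :
  \sum_(I : {set 'I_n}) (-1) ^+ #|I| *
     \prod_(k < n) (x k + \sum_(j | j \notin I) u k j) =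
  \sum_(s : {perm 'I_n}) \prod_(k < n) u k (s k).
Proof.
rewrite mixed_difference_prod.
pose h (s : {perm 'I_n}) := [ffun k => Some (s k)].
pose h' (g : {ffun 'I_n -> option 'I_n}) : {perm 'I_n} :=
  insubd (1%g : {perm 'I_n}) [ffun k => odflt k (g k)].
rewrite (reindex h) /=.
  apply: eq_big => [s|s _]; last by apply: eq_bigr => k _; rewrite ffunE.
  apply/forallP => j; apply/codomP; exists ((s^-1)%g j).
  by rewrite ffunE permKV.
exists h' => [s _|g /forallP gs].
  apply: val_inj; rewrite /h' insubdK.
    by apply/ffunP => k; rewrite !ffunE /= -pvalE.
  by rewrite unfold_in; apply/injectiveP => k l; rewrite !ffunE /=; exact: perm_inj.
have sub : {subset [seq Some j | j : 'I_n] <= codom g}.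
  by move=> _ /codomP[j ->]; exact: gs.
have us : uniq [seq Some j | j : 'I_n].
  by rewrite map_inj_uniq ?enum_uniq// => ? ? [].
have sz : (size (codom g) <= size [seq Some j | j : 'I_n])%N.
  by rewrite !size_map.
have [_ codE] := uniq_min_size us sub sz.
have gS k : exists j, g k = Some j.
  have /codomP[j ->] : g k \in [seq Some j | j : 'I_n] by rewrite codE codom_f.
  by exists j.
have ginj : injective g.
  by apply/injectiveP; rewrite /injectiveb /dinjectiveb (leq_size_uniq us sub sz).
have hP : [ffun k => odflt k (g k)] \in
    (fun f : {ffun 'I_n -> 'I_n} => injectiveb f).
  rewrite unfold_in; apply/injectiveP => k l; rewrite !ffunE.
  have [[j gk] [j' gl]] := (gS k, gS l).
  by rewrite gk gl /= => jj'; apply: ginj; rewrite gk gl jj'.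
apply/ffunP => k; rewrite ffunE /h' -pvalE /=.
have := insubdK (1%g : {perm 'I_n}) hP; rewrite /= => ->.
by rewrite ffunE; have [j ->] := gS k.
Qed.
End MixedDifference.

(** * Functions of one variable with vanishing differences *)

Section UnivariateDifferences.
Context {R : realType}.

Lemma poly_difference0 (J : finType) (p : {poly R}) (t h : R) :
  (size p <= #|J|)%N ->
  \sum_(I : {set J}) (-1) ^+ #|I| * p.[t + h *+ (#|J| - #|I|)] = 0.
Proof.
move=> pJ; under eq_bigr => I _ do rewrite horner_coef mulr_sumr.
rewrite exchange_big big1//= => i _.
under eq_bigr => I _ do rewrite mulrCA.
rewrite -mulr_sumr.
have := @mixed_difference_prod0 R J i (fun=> t) (fun _ _ => h)
  (leq_trans (ltn_ord i) pJ).
move=> E; rewrite [X in _ * X](_ : _ = 0) ?mulr0// -[RHS]E.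
apply: eq_bigr => I _; congr (_ * _); rewrite prodr_const card_ord.
congr (_ ^+ _); congr (_ + _); rewrite sumr_const; congr (_ *+ _).
by rewrite -(cardsC I) addKn; apply: eq_card => j; rewrite !inE.
Qed.

Definition lagrange_base (N k : nat) : {poly R} :=
  \prod_(i < N | i != k :> nat) ((k%:R - i%:R)^-1 *: ('X - i%:R%:P)).

Lemma lagrange_baseE N k l : (k < N)%N -> (l < N)%N ->
  (lagrange_base N k).[l%:R] = (k == l)%:R.
Proof.
move=> kN lN; rewrite horner_prod; have [<-|kl] := eqVneq k l.
  rewrite big1//= => i ik; rewrite hornerZ hornerXsubC mulVf// subr_eq0.
  by rewrite eqr_nat eq_sym.
rewrite (bigD1 (Ordinal lN)) /=; last by rewrite eq_sym.
by rewrite hornerZ hornerXsubC subrr mulr0 mul0r.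
Qed.

Lemma size_lagrange_base N k : (k < N)%N -> (size (lagrange_base N k) <= N)%N.
Proof.
move=> kN; apply: (leq_trans (size_prod_leq _ _)).
have -> : \sum_(i < N | i != k :> nat)
   size ((k%:R - i%:R)^-1 *: ('X - i%:R%:P) : {poly R}) =
   \sum_(i < N | i != k :> nat) 2.
  apply: eq_bigr => i ik; rewrite size_scale ?size_XsubC//.
  by rewrite invr_eq0 subr_eq0 eqr_nat eq_sym.
rewrite sum_nat_const; have -> : #|(fun i : 'I_N => i != k :> nat)| = N.-1.
  have := cardC1 (Ordinal kN); rewrite card_ord => <-.
  by apply: eq_card => i; rewrite !inE.
by case: N kN => // N _; rewrite /= muln2 -addnn; lia.
Qed.

Definition interpolant (N : nat) (u : nat -> R) : {poly R} :=
  \sum_(k < N) u k *: lagrange_base N k.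

Lemma size_interpolant N u : (size (interpolant N u) <= N)%N.
Proof.
apply: (leq_trans (size_sum _ _ _)); apply/bigmax_leqP => k _.
by apply: (leq_trans (size_scale_leq _ _)); exact: size_lagrange_base.
Qed.

Lemma interpolantE N u l : (l < N)%N -> (interpolant N u).[l%:R] = u l.
Proof.
move=> lN; rewrite horner_sum (bigD1 (Ordinal lN))//= hornerZ lagrange_baseE//.
rewrite eqxx mulr1 big1 ?addr0// => k /negPf kl.
by rewrite hornerZ lagrange_baseE// (_ : (k == l :> nat) = false) ?mulr0.
Qed.

(** Both sides satisfy the same recurrence of order #|J|, whose leading term is
    the one of the empty set, and they agree at the first #|J| places. *)
Lemma sequence_of_differences (J : finType) (u : nat -> R) :
  (forall i, \sum_(I : {set J}) (-1) ^+ #|I| * u (i + (#|J| - #|I|))%N = 0) ->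
  forall i, u i = (interpolant #|J| u).[i%:R].
Proof.
move=> du; pose p := interpolant #|J| u.
elim/ltn_ind => i IH; have [iN|Ni] := ltnP i #|J|; first by rewrite interpolantE.
have dp := @poly_difference0 J p (i - #|J|)%:R 1 (size_interpolant _ _).
have := du (i - #|J|)%N; rewrite -[RHS]dp.
rewrite (bigD1 finset.set0)//= [RHS](bigD1 finset.set0)//=.
rewrite cards0 expr0 !mul1r subn0.
rewrite subnK// -natrD subnK//.
have -> : \sum_(I : {set J} | I != finset.set0)
     (-1) ^+ #|I| * u (i - #|J| + (#|J| - #|I|))%N =
  \sum_(I : {set J} | I != finset.set0)
     (-1) ^+ #|I| * p.[(i - #|J|)%:R + 1 *+ (#|J| - #|I|)].
  apply: eq_bigr => I I0; congr (_ * _); rewrite -natrD; apply: IH.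
  have I_gt0 : (0 < #|I|)%N by rewrite card_gt0.
  have IJ : (#|I| <= #|J|)%N by exact: max_card.
  by rewrite -[ltnRHS](subnK Ni) ltn_add2l ltn_subrL I_gt0 (leq_trans I_gt0 IJ).
exact: addIr.
Qed.

(** On each lattice (1 / b) Z, the function g is a polynomial. These polynomials
    agree on the integers, hence are the same, so g is a polynomial on the
    rationals. Monotonicity then squeezes g between close rational points. *)
Lemma function_of_differences (J : finType) (g : R -> R) :
  (forall t h, 0 <= t -> 0 <= h ->
     \sum_(I : {set J}) (-1) ^+ #|I| * g (t + h *+ (#|J| - #|I|)) = 0) ->
  (forall s t, 0 <= s -> s <= t -> g s <= g t) ->
  forall t, 0 <= t -> g t = (interpolant #|J| (fun k => g k%:R)).[t].
Proof.
move=> dg mg; set q := interpolant _ _.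
have lattice b i : (0 < b)%N ->
    g (i%:R / b%:R) = (interpolant #|J| (fun k => g (k%:R / b%:R))).[i%:R].
  move=> b0; apply: (@sequence_of_differences J (fun k => g (k%:R / b%:R))) => k.
  rewrite -[RHS](dg (k%:R / b%:R) b%:R^-1) ?divr_ge0 ?invr_ge0//.
  by apply: eq_bigr => I _; rewrite natrD mulrDl (mulr_natl _ (_ - _)%N).
(* The polynomials of the lattices of steps 1 / b and 1 agree at the integers
   b k, of which there are more than the degree allows. *)
have grat b i : (0 < b)%N -> g (i%:R / b%:R) = q.[i%:R / b%:R].
  move=> b0; have bn0 : b%:R != 0 :> R by rewrite pnatr_eq0 -lt0n.
  rewrite lattice//; set p := interpolant _ _.
  have -> : p = q \Po (b%:R^-1 *: 'X).
    apply/eqP; rewrite -subr_eq0; apply/eqP.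
    pose r := p - (q \Po (b%:R^-1 *: 'X)).
    apply: (@roots_geq_poly_eq0 _ _ [seq (b * k)%:R | k <- iota 0 (size r)]).
    - apply/allP => _ /mapP[k _ ->]; rewrite rootE !hornerE horner_comp !hornerE.
      have e : (b * k)%:R / b%:R = k%:R :> R.
        by rewrite natrM mulrAC mulfV// mul1r.
      rewrite /p -lattice// [b%:R^-1 * _]mulrC !e.
      have := lattice 1%N k isT; rewrite divr1 => ->.
      rewrite subr_eq0 /q; apply/eqP; congr (_.[_]); congr (interpolant _ _).
      by apply/funext => l; rewrite divr1.
    - rewrite map_inj_in_uniq ?iota_uniq// => k l _ _ /eqP.
      by rewrite eqr_nat eqn_mul2l eqn0Ngt b0 => /eqP.
    - by rewrite size_map size_iota.
  by rewrite horner_comp !hornerE mulrC.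
move=> t t0; apply/eqP; rewrite -subr_eq0 -normr_le0; apply/ler_addgt0Pl => e e0.
rewrite addr0.
have /cvgrPdist_lt /(_ e e0) /nbhs_ballP[d /= d0 Hd] := @continuous_horner R q t.
have [b bd] : exists b, b.+1%:R^-1 < d.
  by have [b] := @ltr_add_invr R 0 d d0; rewrite add0r; exists b.
have b0 : 0 < b.+1%:R :> R by rewrite ltr0n.
pose i := Num.truncn (t * b.+1%:R).
have /andP[il ir] := truncn_itv (mulr_ge0 t0 (ltW b0)); rewrite -/i in il ir.
have r1t : i%:R / b.+1%:R <= t by rewrite ler_pdivrMr.
have r2t : t <= i.+1%:R / b.+1%:R by rewrite ler_pdivlMr// ltW.
have rr : i.+1%:R / b.+1%:R = i%:R / b.+1%:R + b.+1%:R^-1 :> R.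
  by rewrite -natr1 mulrDl mul1r.
have := mg _ _ (divr_ge0 (ler0n _ i) (ltW b0)) r1t; rewrite grat// => h1.
have := mg _ _ t0 r2t; rewrite grat// => h2.
move: r1t r2t rr bd h1 h2.
set r1 := i%:R / _; set r2 := i.+1%:R / _; set bi := b.+1%:R^-1.
move=> r1t r2t rr bd h1 h2.
have /Hd /= : ball t d r1.
  by rewrite /ball /= ger0_norm; lra.
have /Hd /= : ball t d r2.
  by rewrite /ball /= ler0_norm; lra.
rewrite !ltr_norml => /andP[? ?] /andP[? ?].
by rewrite ler_norml; apply/andP; split; lra.
Qed.

End UnivariateDifferences.

(** * Minkowski's theorem *)

Section VolumeOfMinkowskiComb.
Context {R : realType} {n m : nat}.
Variable A : 'I_m -> set 'rV[R]_n.
Hypothesis polyA : forall i, polytope (A i).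
Implicit Types (x : 'I_m -> R).

Let convA i : is_convex (A i). Proof. exact: polytope_convex. Qed.
Let compA i : compact (A i). Proof. exact: polytope_compact. Qed.

(** Inclusion-exclusion for the vertices of A_j, scaled by h, with the other
    summands as C: the layers are then translates of Minkowski combinations in
    which only the coefficient of A_j varies. N is the number of vertices. *)
Lemma volume_difference (j : 'I_m) : exists N : nat, forall x h,
  (forall i, 0 <= x i) -> 0 <= h ->
  \sum_(I : {set 'I_N}) (-1) ^+ #|I| *
    volume (minkowski_comb
      (fun i => x i + single_weight j (h *+ (#|'I_N| - #|I|)) i) A) = 0.
Proof.
have [s [s0 AjE]] := polyA j; exists (size s) => x h x0 h0.
pose J := 'I_(size s); pose B (i : J) := [set s`_i].
pose C := minkowski_comb x A.
have cB (i : J) : is_convex (B i) by exact: is_convex_set1.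
have neB (i : J) : B i !=set0 by exists s`_i.
have J_gt0 : (0 < #|J|)%N by rewrite card_ord lt0n size_eq0.
pose K (I : {set J}) := minkowski_comb
  (fun i => x i + single_weight j (h *+ (#|J| - #|I|)) i) A.
have cK (I : {set J}) : compact (K I) by exact: minkowski_comb_compact.
pose w (I : {set J}) := h *: \sum_(i in I) s`_i.
have layerE (I : {set J}) : hull_layer B C h I = [set 1 *: v + w I | v in K I].
  have k0 : 0 <= h *+ (#|J| - #|I|) by rewrite mulrn_wge0.
  apply/seteqP; split => [p [c [b [q [Cc Bb Hq ->]]]]|p [v Kv <-]].
    exists (c + (h *+ (#|J| - #|I|)) *: q).
      apply/(minkowski_comb_addw _ (convA (i:=j)) (x0 j) k0).
      by exists c, q; split => //; rewrite AjE -bigcup_nth.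
    rewrite scale1r addrAC; congr (_ + h *: _ + _).
    by apply: eq_bigr => i _; rewrite (Bb i).
  move: Kv => /(minkowski_comb_addw _ (convA (i:=j)) (x0 j) k0)[c [q [Cc Aq ->]]].
  exists c, (fun i : J => s`_i), q; split => //.
    by rewrite /B bigcup_nth -AjE.
  by rewrite scale1r addrAC.
have cL (I : {set J}) : compact (hull_layer B C h I).
  by rewrite layerE; exact: compact_affine.
rewrite -[RHS](volume_sum_indic (s := fun I : {set J} => (-1) ^+ #|I|) cL).
  apply: eq_bigr => I _; congr (_ * _).
  by rewrite layerE volume_affine// expr1n mul1r.
by move=> p; apply: hull_inclusion_exclusion => //; exact: minkowski_comb_convex.
Qed.

(** Adding a multiple of A_j contains a translate of the body, even if A_j does
    not contain the origin. *)
Lemma volume_comb_mono x (j : 'I_m) (s t : R) : (forall i, 0 <= x i) ->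
  0 <= s -> s <= t ->
  volume (minkowski_comb (fun i => x i + single_weight j s i) A) <=
  volume (minkowski_comb (fun i => x i + single_weight j t i) A).
Proof.
move=> x0 s0 st; have [v Av] := polytope_nonempty (polyA j).
have cK y : compact (minkowski_comb y A) by exact: minkowski_comb_compact.
set K := minkowski_comb _ A; set L := minkowski_comb _ A.
rewrite (_ : volume K = volume [set 1 *: u + (t - s) *: v | u in K]); last first.
  by rewrite volume_affine ?expr1n ?mul1r//; exact: cK.
apply: le_volume; [apply: compact_affine; exact: cK | exact: cK |].
move=> _ [u Ku <-].
have y0 : 0 <= x j + single_weight j s j by rewrite /single_weight eqxx addr_ge0.
have ts0 : 0 <= t - s by rewrite subr_ge0.
have -> : L = minkowski_comb (fun i => (x i + single_weight j s i) +
    single_weight j (t - s) i) A.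
  congr (minkowski_comb _ A); apply/funext => i; rewrite /single_weight.
  by case: ifP => _; lra.
apply/(minkowski_comb_addw _ (convA (i:=j)) y0 ts0).
by exists u, v; split => //; rewrite scale1r.
Qed.

Lemma volume_combZ x (t : R) : 0 < t ->
  volume (minkowski_comb (fun i => t * x i) A) =
  t ^+ n * volume (minkowski_comb x A).
Proof.
move=> t0; rewrite -(volume_affine 0 t0); last exact: minkowski_comb_compact.
congr volume; apply/seteqP; split => [_ [a Aa ->]|_ [_ [a Aa ->] <-]].
  exists (\sum_i x i *: a i); first by exists a.
  by rewrite addr0 scaler_sumr; apply: eq_bigr => i _; rewrite scalerA.
exists a => //; rewrite addr0 scaler_sumr.
by apply: eq_bigr => i _; rewrite scalerA.
Qed.

End VolumeOfMinkowskiComb.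

Section SeparatelyPolynomial.
Context {R : realType} {m : nat}.
Implicit Types (x y : 'I_m -> R) (f : ('I_m -> R) -> R).

Definition set_coord x (j : 'I_m) (t : R) : 'I_m -> R :=
  fun i => if i == j then t else x i.

Definition mpoly_on_orthant f :=
  exists P : {mpoly R[m]}, forall x, (forall i, 0 <= x i) -> f x = P.@[x].

(** The interpolation formula expresses f by its values at finitely many places
    of the coordinate j; the coordinates are treated one after the other, the
    remaining ones being frozen at y. *)
Lemma separately_polynomial f :
  (forall j, exists N, forall x, (forall i, 0 <= x i) -> forall t, 0 <= t ->
    f (set_coord x j t) =
    (interpolant N (fun k => f (set_coord x j k%:R))).[t]) ->
  mpoly_on_orthant f.
Proof.
move=> /choice[N fN].
pose mix (l : seq 'I_m) x y := fun i => if i \in l then x i else y i.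
suff H l y : (forall i, 0 <= y i) -> mpoly_on_orthant (fun x => f (mix l x y)).
  have [P PE] := H (enum 'I_m) (fun=> 0) (fun=> lexx 0).
  exists P => x x0; rewrite -PE//; congr f; apply/funext => i.
  by rewrite /mix mem_enum.
elim: l y => [|j l IH] y y0; first by exists (f y)%:MP => x _; rewrite mevalC.
have [jl|jl] := boolP (j \in l).
  have [P PE] := IH y y0; exists P => x x0; rewrite -PE//; congr f.
  by apply/funext => i; rewrite /mix inE; case: eqP => [->|//]; rewrite jl.
have y0' k : forall i, 0 <= set_coord y j k%:R i.
  by move=> i; rewrite /set_coord; case: ifP.
have /choice[P PE] k := IH _ (y0' k).
pose toX (p : {poly R}) : {mpoly R[m]} := \sum_(i < size p) p`_i *: 'X_j ^+ i.
exists (\sum_(k < N j) P k * toX (lagrange_base (N j) k)) => x x0.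
have -> : mix (j :: l) x y = set_coord (mix l x y) j (x j).
  apply/funext => i; rewrite /mix /set_coord inE.
  by case: eqP => [->|].
rewrite fN//; last by move=> i; rewrite /mix; case: ifP.
rewrite /interpolant horner_sum raddf_sum /=; apply: eq_bigr => k _.
rewrite hornerZ mevalM -PE//; congr (f _ * _).
  apply/funext => i; rewrite /mix /set_coord; case: eqP => [->|//].
  by rewrite (negPf jl).
rewrite horner_coef /toX raddf_sum /=; apply: eq_bigr => i _.
by rewrite mevalZ rmorphXn /= mevalXU.
Qed.

(** For fixed x the identity f (t x) = t^n f x is one between polynomials in t;
    compare the coefficients of t^n. This holds for every polynomial that
    represents f on the orthant, so also for the one that [volume_poly]
    picks. *)
Lemma homogeneous_part f (P : {mpoly R[m]}) (n : nat) :
  (forall x, (forall i, 0 <= x i) -> f x = P.@[x]) ->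
  (forall x t, (forall i, 0 <= x i) -> 0 < t ->
     f (fun i => t * x i) = t ^+ n * f x) ->
  forall x, (forall i, 0 <= x i) -> f x = (pihomog mdeg n P).@[x].
Proof.
move=> fP fh x x0.
pose q : {poly R} :=
  \sum_(a <- msupp P) (P@_a * \prod_i x i ^+ a i) *: 'X^(mdeg a).
have qE t : 0 < t -> q.[t] = t ^+ n * f x.
  move=> t0; rewrite -fh// fP; last by move=> i; rewrite mulr_ge0// ltW.
  rewrite mevalE horner_sum; apply: eq_bigr => a _.
  rewrite hornerZ hornerXn -mulrA; congr (_ * _).
  under [RHS]eq_bigr => i _ do rewrite exprMn.
  by rewrite big_split /= mulrC mdegE expr_sum.
have {qE} qE : q = f x *: 'X^n.
  apply/eqP; rewrite -subr_eq0; apply/eqP.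
  pose r := q - f x *: 'X^n.
  apply: (@roots_geq_poly_eq0 _ _ [seq k.+1%:R | k <- iota 0 (size r)]).
  - apply/allP => _ /mapP[k _ ->]; rewrite rootE !hornerE qE//.
    by rewrite mulrC subrr.
  - rewrite map_inj_in_uniq ?iota_uniq// => k l _ _ /eqP.
    by rewrite eqr_nat => /eqP[].
  - by rewrite size_map size_iota.
have := congr1 (fun p : {poly R} => p`_n) qE.
rewrite /= coefZ coefXn eqxx mulr1 => <-.
rewrite pihomogE raddf_sum /= coef_sum [RHS]big_mkcond /=.
apply: eq_bigr => a _; rewrite coefZ coefXn [n == _]eq_sym.
by case: eqP => _; rewrite ?mulr0// mulr1 mevalZ mevalX.
Qed.

End SeparatelyPolynomial.

Section Minkowski.
Context {R : realType} {n m : nat}.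

Theorem minkowski_volume_poly (A : 'I_m -> set 'rV[R]_n) :
  (forall i, polytope (A i)) ->
  exists2 P : {mpoly R[m]}, P \is n.-homog &
    forall x, (forall i, 0 <= x i) -> P.@[x] = volume (minkowski_comb x A).
Proof.
move=> pA; pose f x := volume (minkowski_comb x A).
have [P PE] : mpoly_on_orthant f.
  apply: separately_polynomial => j; have [N dN] := volume_difference pA j.
  exists N => x x0 t t0.
  pose x' := set_coord x j 0.
  have x'0 i : 0 <= x' i by rewrite /x' /set_coord; case: ifP.
  have gE (s : R) : f (set_coord x j s) =
      volume (minkowski_comb (fun i => x' i + single_weight j s i) A).
    rewrite /f; congr (volume (minkowski_comb _ A)); apply/funext => i.
    by rewrite /x' /set_coord /single_weight; case: ifP; rewrite ?add0r ?addr0.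
  have := @function_of_differences R 'I_N (fun s => f (set_coord x j s)).
  rewrite card_ord; apply => //.
    move=> s h s0 h0; pose y := set_coord x j s.
    have y0 i : 0 <= y i by rewrite /y /set_coord; case: ifP.
    rewrite -[RHS](dN y h y0 h0); apply: eq_bigr => I _; rewrite card_ord.
    congr (_ * volume (minkowski_comb _ A)); apply/funext => i.
    by rewrite /y /set_coord /single_weight; case: ifP; rewrite ?addr0.
  by move=> s u s0 su; rewrite !gE; exact: volume_comb_mono.
exists (pihomog mdeg n P); first exact: pihomogP.
move=> x x0; rewrite -(homogeneous_part PE)// => y t y0 t0.
exact: volume_combZ.
Qed.
End Minkowski.

(** * Polarization of homogeneous polynomials *)

Section MonomialWord.
Context {m : nat}.
Implicit Types (c : 'X_{1..m}).

(** A monomial as the list of its variables with multiplicity, which makes it a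
    product of linear forms. *)
Definition monomial_word c : seq 'I_m :=
  flatten [seq nseq (c j) j | j <- enum 'I_m].

Lemma size_monomial_word c : size (monomial_word c) = mdeg c.
Proof.
rewrite size_flatten sumnE /shape big_map big_map big_enum /= mdegE.
by apply: eq_bigr => j _; rewrite size_nseq.
Qed.

Lemma count_monomial_word c (j : 'I_m) :
  count_mem j (monomial_word c) = c j.
Proof.
rewrite count_flatten sumnE 2!big_map big_enum /= (bigD1 j)//=.
rewrite count_nseq /= eqxx mul1n big1 ?addn0// => i /negPf ij.
by rewrite count_nseq /= ij.
Qed.

Lemma prod_monomial_word (K : comNzRingType) c (x : 'I_m -> K) :
  \prod_(j <- monomial_word c) x j = \prod_j x j ^+ c j.
Proof.
rewrite big_flatten big_map big_enum /=; apply: eq_bigr => j _.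
by rewrite big_nseq -Monoid.iteropE.
Qed.

Lemma repeat_bodiesE (R : realType) n (A : 'I_m -> set 'rV[R]_n) c :
  repeat_bodies A c = map A (monomial_word c).
Proof.
rewrite /repeat_bodies /monomial_word map_flatten -map_comp; congr flatten.
by apply: eq_map => j /=; rewrite map_nseq.
Qed.

Lemma monomial_word_perm n (h : 'I_n -> 'I_m) :
  perm_eq (monomial_word (\sum_(i < n) U_(h i))%MM) [tuple h i | i < n].
Proof.
apply/allP => j _ /=; rewrite count_monomial_word mnm_sumE.
rewrite count_map -sum1_count big_enum_cond /= [X in _ == X]big_mkcond /=.
by apply/eqP/eq_bigr => i _; rewrite mnm1E; case: eqP.
Qed.

End MonomialWord.

Section Polarization.
Context {R : realType} {n m : nat}.
Implicit Types (P : {mpoly R[m.+1]}) (v a b : 'I_n -> 'I_m.+1 -> R).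

(** For P homogeneous of degree n, this is n! times its polar form at the n
    vectors v_j, as a mixed difference at the origin. *)
Definition polar P v : R :=
  \sum_(I : {set 'I_n}) (-1) ^+ #|I| *
    P.@[fun l => \sum_(j | j \notin I) v j l].

(** Read only at places below the degree, hence never at the default. *)
Definition letter (c : 'X_{1..m.+1}) (k : nat) : 'I_m.+1 :=
  nth ord0 (monomial_word c) k.

Lemma mixed_difference_homog P (x : 'I_m.+1 -> R) v : P \is n.-homog ->
  \sum_(I : {set 'I_n}) (-1) ^+ #|I| *
    P.@[fun l => x l + \sum_(j | j \notin I) v j l] =
  \sum_(c <- msupp P) P@_c *
    \sum_(s : {perm 'I_n}) \prod_k v (s k) (letter c k).
Proof.
move=> /dhomogP hP.
under eq_bigr => I _ do rewrite mevalE mulr_sumr.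
rewrite exchange_big /= big_seq [RHS]big_seq; apply: eq_bigr => c cP.
under eq_bigr => I _ do rewrite mulrCA.
rewrite -mulr_sumr; congr (_ * _).
rewrite -(mixed_difference_prod_perm (fun k => x (letter c k))
  (fun k j => v j (letter c k))).
apply: eq_bigr => I _; congr (_ * _); rewrite -prod_monomial_word.
by rewrite (big_nth ord0) size_monomial_word (hP _ cP) big_mkord.
Qed.

Lemma polarE P v : P \is n.-homog ->
  polar P v = \sum_(c <- msupp P) P@_c *
    \sum_(s : {perm 'I_n}) \prod_k v (s k) (letter c k).
Proof.
move=> hP; rewrite -(mixed_difference_homog (fun=> 0))// /polar.
apply: eq_bigr => I _; congr (_ * _.@[_]).
by apply/funext => l; rewrite add0r.
Qed.

Lemma polar_perm P v (p : {perm 'I_n}) : P \is n.-homog ->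
  polar P (v \o p) = polar P v.
Proof.
move=> hP; have pE := polarE _ hP.
rewrite !pE; apply: eq_bigr => c _; congr (_ * _).
rewrite [RHS](reindex_inj (mulIg p)) /=; apply: eq_bigr => s _.
by apply: eq_bigr => k _; rewrite permM.
Qed.

(** The left-hand side expands, by additivity in each argument, the polar form
    at the vectors a_j - b_j; the right-hand side computes it as the mixed
    difference at the base point sum_j b_j. *)
Lemma polar_sum_sub P a b : P \is n.-homog ->
  \sum_(I : {set 'I_n}) (-1) ^+ #|I| *
    polar P (fun j => if j \in I then b j else a j) =
  \sum_(I : {set 'I_n}) (-1) ^+ #|I| *
    P.@[fun l => \sum_j (if j \in I then b j else a j) l].
Proof.
move=> hP; have pE := polarE _ hP.
transitivity (\sum_(I : {set 'I_n}) (-1) ^+ #|I| *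
    P.@[fun l => \sum_j b j l + \sum_(j | j \notin I) (a j l - b j l)]);
    last first.
  apply: eq_bigr => I _; congr (_ * _.@[_]); apply/funext => l.
  rewrite [X in _ + X]big_mkcond -big_split /=; apply: eq_bigr => j _.
  by case: (j \in I); rewrite /= ?addr0// addrC subrK.
rewrite (mixed_difference_homog (fun l => \sum_j b j l)
  (fun j l => a j l - b j l))//.
under eq_bigr => I _ do rewrite pE mulr_sumr.
rewrite exchange_big /=; apply: eq_bigr => c _.
under eq_bigr => I _ do rewrite mulrCA mulr_sumr.
rewrite -mulr_sumr; congr (_ * _); rewrite exchange_big /=.
apply: eq_bigr => s _.
have -> : \prod_k (a (s k) (letter c k) - b (s k) (letter c k)) =
    \prod_j (- b j (letter c (s^-1 j)%g) + a j (letter c (s^-1 j)%g)).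
  rewrite [RHS](reindex_inj (@perm_inj _ s)) /=; apply: eq_bigr => k _.
  by rewrite permK addrC.
rewrite bigA_distr /=; apply: eq_bigr => I _.
rewrite (reindex_inj (@perm_inj _ s^-1)%g) /=.
have -> : (-1) ^+ #|I| = \prod_j (if j \in I then -1 else 1) :> R.
  by rewrite -big_mkcond /= prodr_const.
rewrite -big_split /=; apply: eq_bigr => j _; rewrite permKV.
by case: ifP; rewrite ?mulN1r ?mul1r.
Qed.

End Polarization.

Section MixedVolumePolar.
Context {R : realType}.

(** At the indicator of the complement of I, a monomial c is 1 if I consists of
    variables that are absent from c, and 0 otherwise. The signs cancel unless
    no variable is absent, which in degree n leaves x_1 ... x_n only. *)
Lemma coef_multilinear n (P : {mpoly R[n]}) : P \is n.-homog ->
  P@_[multinom 1%N | i < n] =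
  \sum_(I : {set 'I_n}) (-1) ^+ #|I| * P.@[fun i => (i \notin I)%:R].
Proof.
move=> /dhomogP hP.
under eq_bigr => I _ do rewrite mevalE mulr_sumr.
rewrite exchange_big /=.
pose one : 'X_{1..n} := [multinom 1%N | i < n].
have inner c : c \in msupp P ->
    \sum_(I : {set 'I_n})
       (-1) ^+ #|I| * (P@_c * \prod_i (i \notin I)%:R ^+ c i) =
    P@_c * (c == one)%:R.
  move=> cP; under eq_bigr => I _ do rewrite mulrCA.
  rewrite -mulr_sumr; congr (_ * _).
  pose D := [set i | c i == 0%N]%SET.
  have -> : (c == one) = (D == finset.set0).
    apply/eqP/eqP => [cE|D0]; first by apply/setP => i; rewrite !inE cE mnmE.
    have c_gt0 i : (0 < c i)%N.
      by rewrite lt0n; apply: contraFN (finset.in_set0 i); rewrite -D0 inE.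
    have cn : (\sum_i c i = \sum_(i < n) 1)%N.
      by rewrite -mdegE (hP _ cP) sum1_card card_ord.
    apply/mnmP => i; rewrite mnmE; apply/eqP.
    have [_] := leqif_sum (fun (i : 'I_n) (_ : true) => leqif_eq (c_gt0 i)).
    by rewrite cn eqxx => /esym/forallP/(_ i)/eqP <-.
  rewrite -sum_sign_subset [RHS]big_mkcond /=; apply: eq_bigr => I _.
  case: ifP => [/fintype.subsetP ID|/negP nID].
    rewrite big1 ?mulr1// => i _.
    have [iI|_] := boolP (i \in I); last by rewrite expr1n.
    by have := ID i iI; rewrite inE => /eqP ->.
  have [i iI iD] : exists2 i, i \in I & i \notin D.
    by apply/fintype.subsetPn; apply/negP.
  rewrite (bigD1 i)//= iI /= expr0n; move: iD; rewrite inE => /negPf ->.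
  by rewrite mul0r mulr0.
rewrite big_seq (eq_bigr _ inner) -big_seq.
have [oP|oP] := boolP (one \in msupp P).
  rewrite (bigD1_seq one)//= ?msupp_uniq// eqxx mulr1 big1 ?addr0// => c /negPf ->.
  by rewrite mulr0.
rewrite (memN_msupp_eq0 oP) big_seq big1// => c cP.
by case: eqP => [co|_]; [rewrite -co cP in oP|rewrite mulr0].
Qed.

Definition unit_weight m (k : 'I_m) : 'I_m -> R := fun l => (l == k)%:R.

(** All the mixed volumes of bodies drawn from one family A come from the single
    polynomial of A, because substituting A_(f i) for the i-th body amounts to
    summing the variables x_i along f. *)
Lemma mixed_volumeE n m (A : 'I_m.+1 -> set 'rV[R]_n) (f : 'I_n -> 'I_m.+1)
    (P : {mpoly R[m.+1]}) :
  (forall i, polytope (A i)) ->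
  (forall x, (forall i, 0 <= x i) -> P.@[x] = volume (minkowski_comb x A)) ->
  mixed_volume (A \o f) = polar P (fun j => unit_weight (f j)).
Proof.
move=> pA PE.
have pAf i : polytope ((A \o f) i) by exact: pA.
have [Q0 _ Q0E] := minkowski_volume_poly pAf.
pose g (x : 'I_n -> R) := volume (minkowski_comb x (A \o f)).
have QE : forall x, (forall i, 0 <= x i) -> g x = (volume_poly (A \o f)).@[x].
  move=> x x0; rewrite /volume_poly; case: xgetP => [Q -> QE|/(_ Q0)].
    by rewrite QE.
  by move=> H; exfalso; exact: H.
have gh x t : (forall i, 0 <= x i) -> 0 < t ->
    g (fun i => t * x i) = t ^+ n * g x.
  by move=> _ t0; exact: volume_combZ.
have QnE := homogeneous_part QE gh.
have QnH := pihomogP mdeg n (volume_poly (A \o f)).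
have one : mdeg [multinom 1%N | i < n] = n.
  by rewrite mdegE; under eq_bigr do rewrite mnmE; rewrite sum1_card card_ord.
have -> : mixed_volume (A \o f) =
    (pihomog mdeg n (volume_poly (A \o f)))@_[multinom 1%N | i < n].
  rewrite pihomogE raddf_sum /= /mixed_volume {1}[volume_poly _]mpolyE.
  rewrite raddf_sum /= [RHS]big_mkcond /=; apply: eq_bigr => c _; rewrite mcoeffZ mcoeffX.
  case: ifP => // cn; case: eqP => [cE|_]; last by rewrite mulr0.
  by rewrite cE one eqxx in cn.
rewrite coef_multilinear// /polar; apply: eq_bigr => I _; congr (_ * _).
rewrite -QnE; last by move=> i; rewrite ler0n.
rewrite PE; last by move=> l; apply: sumr_ge0 => j _; rewrite ler0n.
rewrite /g minkowski_comb_comp//.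
- congr (volume (minkowski_comb _ A)); apply/funext => l.
  rewrite big_mkcond [RHS]big_mkcond /=; apply: eq_bigr => j _.
  by rewrite /unit_weight eq_sym; case: (_ == _); case: (_ \in _).
- by move=> i; exact: polytope_convex.
- by move=> i; exact: polytope_nonempty.
Qed.

End MixedVolumePolar.

(** * Evaluation of the product at mixed volumes *)

Section Evaluation.
Context {R : realType}.

(** Distinct j may have the same monomial a_j, and cancel: hence the sum over
    the support is first extended to all the monomials involved. *)
Lemma sum_msuppE m (J : finType) (s : J -> R) (a : J -> 'X_{1..m})
    (F : 'X_{1..m} -> R) (P : {mpoly R[m]}) :
  P = \sum_j s j *: 'X_[a j] ->
  \sum_(c <- msupp P) P@_c * F c = \sum_j s j * F (a j).
Proof.
move=> PE; pose r := undup (msupp P ++ codom a).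
have rP : \sum_(c <- msupp P) P@_c * F c = \sum_(c <- r) P@_c * F c.
  rewrite [RHS](bigID (mem (msupp P))) /= [X in _ = _ + X]big1; last first.
    by move=> c /memN_msupp_eq0 ->; rewrite mul0r.
  rewrite addr0 -[RHS]big_filter; apply: perm_big; apply: uniq_perm.
  - exact: msupp_uniq.
  - by rewrite filter_uniq// undup_uniq.
  - move=> c; rewrite mem_filter mem_undup mem_cat /=.
    by case: (c \in msupp P).
rewrite rP {1}PE.
under eq_bigr => c _ do rewrite raddf_sum /= mulr_suml.
rewrite exchange_big /=; apply: eq_bigr => j _.
have ar : a j \in r by rewrite mem_undup mem_cat codom_f orbT.
rewrite (bigD1_seq (a j))//= ?undup_uniq// mcoeffZ mcoeffX eqxx mulr1.
rewrite big1 ?addr0// => c /negPf cj.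
by rewrite mcoeffZ mcoeffX eq_sym cj mulr0 mul0r.
Qed.

Lemma prod_subXE n m (f g : 'I_n -> 'I_m) :
  \prod_(i < n) ('X_(f i) - 'X_(g i)) =
  \sum_(I : {set 'I_n}) ((-1) ^+ #|I|) *:
    'X_[\sum_(i < n) U_(if i \in I then g i else f i)] :> {mpoly R[m]}.
Proof.
under eq_bigr => i _ do rewrite addrC.
rewrite bigA_distr /=; apply: eq_bigr => I _.
rewrite -mprodXE -mul_mpolyC rmorphXn rmorphN1.
have -> : (-1) ^+ #|I| = \prod_j (if j \in I then -1 else 1) :> {mpoly R[m]}.
  by rewrite -big_mkcond /= prodr_const.
rewrite -big_split /=; apply: eq_bigr => i _.
by case: ifP; rewrite ?mulN1r ?mul1r.
Qed.

End Evaluation.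

(** The product of the A_(f i) - A_(g i), evaluated at mixed volumes, is the
    n-fold difference of the volume from the sum of the A_(f i) to the sum of
    the A_(g i). *)
Lemma mixed_eval_prod_sub (R : realType) (n m : nat)
    (A : 'I_m.+1 -> set 'rV[R]_n) (f g : 'I_n -> 'I_m.+1) : (forall i, polytope (A i)) ->
  mixed_eval (\prod_(i < n) ('X_(f i) - 'X_(g i)) : {mpoly R[m.+1]}) A =
  \sum_(I : {set 'I_n}) (-1) ^+ #|I| * volume (minkowski_comb
    (fun l => \sum_i unit_weight (if i \in I then g i else f i) l) A).
Proof.
move=> pA; have [P hP PE] := minkowski_volume_poly pA.
transitivity (\sum_(I : {set 'I_n}) (-1) ^+ #|I| *
    polar P (fun i => if i \in I then unit_weight (g i)
                      else unit_weight (f i))).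
  rewrite /mixed_eval (sum_msuppE _ (prod_subXE f g)).
  apply: eq_bigr => I _; congr (_ * _).
  set h := fun i => if i \in I then g i else f i.
  have /tuple_permP[p wE] := monomial_word_perm h.
  rewrite (_ : (fun i => _) = A \o (h \o p)); last first.
    apply/funext => i; rewrite repeat_bodiesE wE (nth_map ord0) ?size_tuple//.
    by rewrite -tnth_nth !tnth_mktuple.
  rewrite (mixed_volumeE _ pA PE).
  rewrite [LHS](polar_perm (fun j => unit_weight (h j)) p hP).
  congr polar; apply/funext => i; rewrite /h.
  by case: ifP.
rewrite (polar_sum_sub _ _ hP); apply: eq_bigr => I _; congr (_ * _).
rewrite -PE => [|l]; last by apply: sumr_ge0 => i _; rewrite ler0n.
congr (_.@[_]); apply/funext => l; apply: eq_bigr => i _.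
by case: ifP.
Qed.

(* In the n.+1 variables of the polynomial, ord0 stands for B and lift ord0 i
   for B_i. *)
Theorem corollary1p5 (R : realType) (n : nat) (n_gt0 : (0 < n)%N)
    (B_ : 'I_n -> set 'rV[R]_n) (polyB : forall i, polytope (B_ i)) :
  let B := convex_hull (\bigcup_i B_ i) in
  mixed_eval
    (\prod_(i < n) ('X_ord0 - 'X_(lift ord0 i)) : {mpoly R[n.+1]})
    (fun j => if unlift ord0 j is Some i then B_ i else B) = 0.
Proof.
move=> B; pose A (j : 'I_n.+1) := if unlift ord0 j is Some i then B_ i else B.
rewrite -/A.
have A0 : A ord0 = B by rewrite /A unlift_none.
have Al i : A (lift ord0 i) = B_ i by rewrite /A liftK.
have polyA j : polytope (A j).
  case: (unliftP ord0 j) => [i ->|->]; first by rewrite Al.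
  by rewrite A0; exact: (polytope_hull_union (Ordinal n_gt0)).
rewrite (mixed_eval_prod_sub (fun=> ord0) (fun i => lift ord0 i) polyA).
pose K (I : {set 'I_n}) := minkowski_comb (fun l => \sum_i unit_weight
  (if i \in I then lift ord0 i else ord0) l) A.
have cK I : compact (K I).
  by apply: minkowski_comb_compact => j; exact: polytope_compact.
apply: (volume_sum_indic (s := fun I : {set 'I_n} => (-1) ^+ #|I|) cK) => p.
rewrite -[RHS](@hull_inclusion_exclusion R n 'I_n B_ _ _ [set 0] 1 p).
- apply: eq_bigr => I _; congr (_ * (nat_of_bool _)%:R).
  apply: asbool_equiv_eq.
  have w0 : \sum_i unit_weight (if i \in I then lift ord0 i else ord0) ord0 =
      1 *+ (#|'I_n| - #|I|) :> R.
    have -> : (#|'I_n| - #|I|)%N = #|~: I| by rewrite [RHS]cardsCs finset.setCK.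
    transitivity (\sum_(i in (~: I)%SET) (1 : R)); last by rewrite sumr_const.
    rewrite [RHS]big_mkcond /=; apply: eq_bigr => i _.
    by rewrite inE /unit_weight; case: ifP.
  have wl j : \sum_i unit_weight (if i \in I then lift ord0 i else ord0)
      (lift ord0 j) = (j \in I)%:R :> R.
    rewrite (bigD1 j)//= big1 ?addr0 => [|i ij]; rewrite /unit_weight.
      by case: ifP; rewrite ?eqxx.
    by case: ifP => // _; rewrite (inj_eq lift_inj) eq_sym (negPf ij).
  have combE (a : 'I_n.+1 -> 'rV[R]_n) : \sum_l (\sum_i unit_weight
      (if i \in I then lift ord0 i else ord0) l) *: a l =
      0 + 1 *: \sum_(j in I) a (lift ord0 j) + (1 *+ (#|'I_n| - #|I|)) *: a ord0.
    rewrite big_ord_recl w0 add0r scale1r addrC; congr (_ + _).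
    rewrite [RHS]big_mkcond /=; apply: eq_bigr => j _; rewrite wl.
    by case: ifP; rewrite ?scale1r ?scale0r.
  split=> [[a Aa ->]|[c [b [q [-> Bb Bq ->]]]]].
    exists 0, (fun j => a (lift ord0 j)), (a ord0); split => //.
    - by move=> j; rewrite -Al.
    - by rewrite -/B -A0.
  exists (fun l => if unlift ord0 l is Some i then b i else q).
    by move=> l; rewrite /A; case: unliftP.
  rewrite combE unlift_none; congr (_ + _ *: _ + _).
  by apply: eq_bigr => j _; rewrite liftK.
- by move=> j; exact: polytope_convex.
- by move=> j; exact: polytope_nonempty.
- by rewrite card_ord.
- exact: ler01.
- exact: is_convex_set1.
Qed.
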